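(* The fundamental group of a finite graph of groups with virtually polycyclic vertex groups and finite edge groups is a Takahasi group.
   Context: For a finitely generated group $H$, $\mathrm{rk}(H)=\min\{|X| : H=\langle X\rangle\}$. A group $G$ is a Takahasi group if every ascending chain $H_1\leq H_2\leq H_3\leq\cdots$ of finitely generated subgroups of $G$ with bounded rank (i.e. there is a constant $M$ with $\mathrm{rk}(H_j)\leq M$ for all $j$) is stationary. A group is polycyclic if it admits a finite subnormal series ending in $\{1\}$ with cyclic factors; it is virtually polycyclic if it has a polycyclic subgroup of finite index. A graph (in the sense of Serre) consists of a nonempty vertex set $V$, an edge set $E$, a map $\alpha:E\to V$ (initial vertex) and a fixed-point-free involution $e\mapsto\bar e$ on $E$. A finite graph of groups $\mathcal{G}$ over a finite connected graph consists of groups $G_v$ ($v\in V$, vertex groups), groups $G_e$ ($e\in E$, edge groups) with $G_{\bar e}=G_e$, and monomorphisms $\alpha_e:G_e\to G_{\alpha(e)}$ ($e\in E$). Given a spanning tree $T\subseteq E$, the fundamental group $\pi_1(\mathcal{G},T)$ is the quotient of $(\ast_{v\in V}G_v)\ast F_E$ ($F_E$ free on $E$) by the normal subgroup generated by $e\bar e$ ($e\in E$), $t$ ($t\in T$), and $e^{-1}\alpha_e(g)\,e\,\alpha_{\bar e}(g)^{-1}$ ($e\in E$, $g\in G_e$); up to isomorphism it does not depend on $T$. *)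

(* Defs.v *)
From HB Require Import structures.
From mathcomp Require Import all_boot.
From mathcomp Require Import boolp classical_sets functions cardinality.

Set Implicit Arguments.
Unset Strict Implicit.
Unset Printing Implicit Defensive.

Local Open Scope classical_set_scope.
Local Open Scope group_scope.
Local Open Scope quotient_scope.

Definition subgroup (G : groupType) (H : set G) : Prop :=
  group_closed [in H].

Definition gen_subgroup (G : groupType) (X : set G) : set G :=
  smallest (@subgroup G) X.

Definition normalises (G : groupType) (H N : set G) : Prop :=
  forall x y : G, H x -> N y -> N (y ^ x).

Definition normal_closure (G : groupType) (X : set G) : set G :=
  smallest [set N | subgroup N /\ normalises [set: G] N] X.

Definition finite_index (G : groupType) (H : set G) : Prop :=
  finite_set (range (fun x : G => *%g x @` H)).

Definition fin_gen (G : groupType) (H : set G) : Prop :=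
  exists2 X : set G, finite_set X & H = gen_subgroup X.

Definition gen_by_card (G : groupType) (H : set G) (n : nat) : Prop :=
  exists2 X : set G, (X #= `I_n)%card & H = gen_subgroup X.

(* The junk branch 0 is reached only when H is not finitely generated. *)
Definition rk (G : groupType) (H : set G) : nat :=
  if pselect (exists n, `[< gen_by_card H n >]) is left ex_n
  then ex_minn ex_n else 0.

Definition takahasi (G : groupType) : Prop :=
  forall H : nat -> set G,
    (forall j, subgroup (H j) /\ fin_gen (H j)) ->
    (forall j, H j `<=` H j.+1) ->
    (exists M, forall j, (rk (H j) <= M)%N) ->
    exists n, forall j, (n <= j)%N -> H j = H n.

(* H / K is cyclic, where K is normal in H: some coset g K has every coset x K
   as an integral power. *)
Definition cyclic_factor (G : groupType) (H K : set G) : Prop :=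
  exists2 g, H g &
    forall x, H x -> exists n, K ((g ^+ n)^-1 * x) \/ K ((g ^- n)^-1 * x).

Definition polycyclic (G : groupType) (H : set G) : Prop :=
  exists (n : nat) (P : nat -> set G),
    [/\ P 0%N = H, P n = [set 1], forall i, (i <= n)%N -> subgroup (P i) &
        forall i, (i < n)%N ->
          [/\ P i.+1 `<=` P i, normalises (P i) (P i.+1) &
              cyclic_factor (P i) (P i.+1)]].

Definition virtually_polycyclic (G : groupType) : Prop :=
  exists H : set G, [/\ subgroup H, finite_index H & polycyclic H].

Section NormalClosure.
Variables (G : groupType) (X : set G).
Local Notation N := (normal_closure X).

Lemma normal_closure1 : N 1.
Proof. by move=> M [[[/set_mem]]]. Qed.

Lemma normal_closureF x y : N x -> N y -> N (x / y).
Proof.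
move=> Nx Ny M nM; case: (nM) => [[[_ MF] _] _].
by apply/set_mem/MF; apply/mem_set; [apply: Nx | apply: Ny].
Qed.

Lemma normal_closureV x : N x -> N x^-1.
Proof. by move=> Nx; rewrite -div1g; apply: normal_closureF => //; apply: normal_closure1. Qed.

Lemma normal_closureM x y : N x -> N y -> N (x * y).
Proof.
by move=> Nx /normal_closureV Ny; rewrite -[y]invgK; apply: normal_closureF.
Qed.

Lemma normal_closureJ x y : N x -> N (x ^ y).
Proof. by move=> Nx M nM; case: (nM) => [[_ MJ] _]; apply: MJ => //; apply: Nx. Qed.

End NormalClosure.

Section QuotBy.
Variables (G : groupType) (X : set G).
Local Notation N := (normal_closure X).

Definition quot_by_rel : rel G := fun x y => `[< N (x^-1 * y) >].

Fact quot_by_rel_refl : reflexive quot_by_rel.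
Proof. by move=> x; apply/asboolP; rewrite mulVg; apply: normal_closure1. Qed.

Fact quot_by_rel_sym : symmetric quot_by_rel.
Proof.
by move=> x y; apply/asboolP/asboolP => /normal_closureV; rewrite invgM invgK.
Qed.

Fact quot_by_rel_trans : transitive quot_by_rel.
Proof.
move=> y x z /asboolP Nxy /asboolP Nyz; apply/asboolP.
have -> : x^-1 * z = (x^-1 * y) * (y^-1 * z) by rewrite mulgA mulgK.
exact: normal_closureM.
Qed.

Canonical quot_by_equiv :=
  EquivRel quot_by_rel quot_by_rel_refl quot_by_rel_sym quot_by_rel_trans.

Definition quot_by := {eq_quot quot_by_equiv}.
HB.instance Definition _ := Choice.on quot_by.
HB.instance Definition _ := EqQuotient.on quot_by.

Definition quot_by_pi (x : G) : quot_by := \pi x.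

Lemma quot_by_piE x y : quot_by_pi x = quot_by_pi y <-> N (x^-1 * y).
Proof.
by split=> [/eqP|H]; [rewrite eqmodE => /asboolP | apply/eqP; rewrite eqmodE; apply/asboolP].
Qed.

Definition quot_by_mul (a b : quot_by) : quot_by := quot_by_pi (repr a * repr b).
Definition quot_by_inv (a : quot_by) : quot_by := quot_by_pi (repr a)^-1.

Lemma repr_quot_by x : N (x^-1 * repr (quot_by_pi x)).
Proof. by apply/quot_by_piE; rewrite /quot_by_pi reprK. Qed.

Lemma quot_by_piM x y :
  quot_by_mul (quot_by_pi x) (quot_by_pi y) = quot_by_pi (x * y).
Proof.
apply/esym/quot_by_piE; have Nx := repr_quot_by x; have Ny := repr_quot_by y.
set x' := repr _ in Nx *; set y' := repr _ in Ny *.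
have -> : (x * y)^-1 * (x' * y') = (x^-1 * x') ^ y * (y^-1 * y').
  by rewrite conjgE invgM !mulgA mulgK.
by apply: normal_closureM => //; apply: normal_closureJ.
Qed.

Lemma quot_by_piV x : quot_by_inv (quot_by_pi x) = quot_by_pi x^-1.
Proof.
apply/quot_by_piE; have Nx := repr_quot_by x; set x' := repr _ in Nx *.
rewrite invgK; have -> : x' * x^-1 = (x^-1 * x') ^ x^-1.
  by rewrite conjgE invgK !mulgA mulgV mul1g.
exact: normal_closureJ.
Qed.

Lemma quot_by_ind (P : quot_by -> Prop) : (forall x, P (quot_by_pi x)) -> forall a, P a.
Proof. by move=> Ppi a; rewrite -[a]reprK; apply: Ppi. Qed.

Fact quot_by_mulA : associative quot_by_mul.
Proof.
by elim/quot_by_ind=> x; elim/quot_by_ind=> y; elim/quot_by_ind=> z; rewrite !quot_by_piM mulgA.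
Qed.
Fact quot_by_mul1g : left_id (quot_by_pi 1) quot_by_mul.
Proof. by elim/quot_by_ind=> x; rewrite quot_by_piM mul1g. Qed.
Fact quot_by_mulg1 : right_id (quot_by_pi 1) quot_by_mul.
Proof. by elim/quot_by_ind=> x; rewrite quot_by_piM mulg1. Qed.
Fact quot_by_mulVg : left_inverse (quot_by_pi 1) quot_by_inv quot_by_mul.
Proof. by elim/quot_by_ind=> x; rewrite quot_by_piV quot_by_piM mulVg. Qed.
Fact quot_by_mulgV : right_inverse (quot_by_pi 1) quot_by_inv quot_by_mul.
Proof. by elim/quot_by_ind=> x; rewrite quot_by_piV quot_by_piM mulgV. Qed.

HB.instance Definition _ := isGroup.Build quot_by
  quot_by_mulA quot_by_mul1g quot_by_mulg1 quot_by_mulVg quot_by_mulgV.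

End QuotBy.

(* Any r gives a group, with inv l as inverse of the letter l: cancellation of l
   against inv l is built into the congruence. *)
Section WordGroup.
Variables (L : choiceType) (inv : L -> L) (r : seq L -> seq L -> Prop).

Inductive word_eq : seq L -> seq L -> Prop :=
| WordRel a b u v of r u v : word_eq (a ++ u ++ b) (a ++ v ++ b)
| WordMulV a b l : word_eq (a ++ [:: l; inv l] ++ b) (a ++ b)
| WordVMul a b l : word_eq (a ++ [:: inv l; l] ++ b) (a ++ b)
| WordRefl u : word_eq u u
| WordSym u v of word_eq u v : word_eq v u
| WordTrans u v w of word_eq u v & word_eq v w : word_eq u w.

Lemma word_eq_ctx a b u v : word_eq u v -> word_eq (a ++ u ++ b) (a ++ v ++ b).
Proof.
elim=> {u v} [c d u v ruv|c d l|c d l|u|u v _|u v w _ ? _].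
- by have := WordRel (a ++ c) (d ++ b) ruv; rewrite -!catA.
- by have := WordMulV (a ++ c) (d ++ b) l; rewrite -!catA.
- by have := WordVMul (a ++ c) (d ++ b) l; rewrite -!catA.
- exact: WordRefl.
- exact: WordSym.
- exact: WordTrans.
Qed.

Lemma word_eq_cat u u' v v' :
  word_eq u u' -> word_eq v v' -> word_eq (u ++ v) (u' ++ v').
Proof.
move=> /(@word_eq_ctx [::] v) uu' /(@word_eq_ctx u' [::]).
by rewrite !cats0; apply: WordTrans.
Qed.

Definition word_inv (u : seq L) := rev (map inv u).

Lemma word_mulV u : word_eq (u ++ word_inv u) [::].
Proof.
rewrite /word_inv; elim: u => [|l u IHu] /=; first exact: WordRefl.
rewrite rev_cons -cats1; have := @word_eq_ctx [:: l] [:: inv l] _ _ IHu.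
rewrite -!catA /= => /WordTrans; apply; exact: (WordMulV [::] [::]).
Qed.

Lemma word_Vmul u : word_eq (word_inv u ++ u) [::].
Proof.
rewrite /word_inv; elim: u => [|l u IHu] /=; first exact: WordRefl.
rewrite rev_cons -cats1 -catA; apply: WordTrans IHu.
exact: (WordVMul _ _ l).
Qed.

Lemma word_eq_inv u v : word_eq u v -> word_eq (word_inv u) (word_inv v).
Proof.
move=> uv; have uV := word_Vmul u; have vV := word_mulV v.
have h1 := word_eq_cat (WordRefl (word_inv u)) vV.
have h2 := word_eq_cat uV (WordRefl (word_inv v)).
have h3 := word_eq_cat (word_eq_cat (WordRefl (word_inv u)) uv) (WordRefl (word_inv v)).
rewrite cats0 catA in h1; apply: WordTrans (WordSym h1) _.
exact: WordTrans (WordSym h3) h2.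
Qed.

Definition word_rel : rel (seq L) := fun u v => `[< word_eq u v >].

Fact word_rel_refl : reflexive word_rel.
Proof. by move=> u; apply/asboolP/WordRefl. Qed.
Fact word_rel_sym : symmetric word_rel.
Proof. by move=> u v; apply/asboolP/asboolP; apply: WordSym. Qed.
Fact word_rel_trans : transitive word_rel.
Proof. by move=> v u w /asboolP uv /asboolP vw; apply/asboolP; apply: WordTrans vw. Qed.

Canonical word_equiv := EquivRel word_rel word_rel_refl word_rel_sym word_rel_trans.

Definition word_group := {eq_quot word_equiv}.
HB.instance Definition _ := Choice.on word_group.
HB.instance Definition _ := EqQuotient.on word_group.

Definition word_pi (u : seq L) : word_group := \pi u.

Lemma word_piE u v : word_pi u = word_pi v <-> word_eq u v.
Proof.
by split=> [/eqP|H]; [rewrite eqmodE => /asboolP | apply/eqP; rewrite eqmodE; apply/asboolP].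
Qed.

Definition word_group_mul (x y : word_group) := word_pi (repr x ++ repr y).
Definition word_group_inv (x : word_group) := word_pi (word_inv (repr x)).

Lemma repr_word u : word_eq (repr (word_pi u)) u.
Proof. by apply/word_piE; rewrite /word_pi reprK. Qed.

Lemma word_piM u v : word_group_mul (word_pi u) (word_pi v) = word_pi (u ++ v).
Proof. by apply/word_piE/word_eq_cat; apply: repr_word. Qed.

Lemma word_piV u : word_group_inv (word_pi u) = word_pi (word_inv u).
Proof. by apply/word_piE/word_eq_inv/repr_word. Qed.

Lemma word_group_ind (P : word_group -> Prop) : (forall u, P (word_pi u)) -> forall x, P x.
Proof. by move=> Ppi x; rewrite -[x]reprK; apply: Ppi. Qed.

Fact word_group_mulA : associative word_group_mul.
Proof.
by elim/word_group_ind=> u; elim/word_group_ind=> v; elim/word_group_ind=> w; rewrite !word_piM catA.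
Qed.
Fact word_group_mul1g : left_id (word_pi [::]) word_group_mul.
Proof. by elim/word_group_ind=> u; rewrite word_piM. Qed.
Fact word_group_mulg1 : right_id (word_pi [::]) word_group_mul.
Proof. by elim/word_group_ind=> u; rewrite word_piM cats0. Qed.
Fact word_group_mulVg : left_inverse (word_pi [::]) word_group_inv word_group_mul.
Proof.
by elim/word_group_ind=> u; rewrite word_piV word_piM; apply/word_piE/word_Vmul.
Qed.
Fact word_group_mulgV : right_inverse (word_pi [::]) word_group_inv word_group_mul.
Proof.
by elim/word_group_ind=> u; rewrite word_piV word_piM; apply/word_piE/word_mulV.
Qed.

HB.instance Definition _ := isGroup.Build word_group
  word_group_mulA word_group_mul1g word_group_mulg1 word_group_mulVg word_group_mulgV.

End WordGroup.

Definition free_letter_inv (A : choiceType) (l : A * bool) := (l.1, ~~ l.2).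

(* The letter (a, false) stands for a, and (a, true) for its inverse. *)
Definition free_group (A : choiceType) : groupType :=
  word_group (@free_letter_inv A) (fun _ _ => False).

Definition free_gen (A : choiceType) (a : A) : free_group A :=
  word_pi _ _ [:: (a, false)].

Section FreeProduct.
Variables (I : choiceType) (G : I -> groupType).

Definition fprod_letter_inv (l : {i & G i}) : {i & G i} :=
  Tagged G (tagged l)^-1.

Inductive fprod_rel : seq {i & G i} -> seq {i & G i} -> Prop :=
| FProd1 i : fprod_rel [:: Tagged G (1 : G i)] [::]
| FProdM i (x y : G i) :
    fprod_rel [:: Tagged G x; Tagged G y] [:: Tagged G (x * y)].

Definition free_product : groupType := word_group fprod_letter_inv fprod_rel.

Definition fprod_in (i : I) (x : G i) : free_product :=
  word_pi _ _ [:: Tagged G x].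

End FreeProduct.

Record finite_graph := FiniteGraph {
  vertex : finType;
  edge : finType;
  src : edge -> vertex;
  bar : edge -> edge;
  vertex_gt0 : (0 < #|vertex|)%N;
  barK : involutive bar;
  bar_neq : forall e, bar e != e }.

Section Trees.
Variables (X : finite_graph) (T : {set edge X}).

Definition adjacent : rel (vertex X) :=
  [rel u v | [exists e in T, (src e == u) && (src (bar e) == v)]].

Definition spans_connected : Prop := forall u v, connect adjacent u v.

Definition reduced_step : rel (edge X) :=
  [rel e f | [&& e \in T, f \in T, src (bar e) == src f & f != bar e]].

Definition acyclic : Prop :=
  forall (e : edge X) (p : seq (edge X)), e \in T ->
    path reduced_step e p -> src (bar (last e p)) <> src e.

(* T is the edge set of a subgraph, so it is closed under e |-> bar e. *)
Definition spanning_tree : Prop :=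
  [/\ forall e, e \in T -> bar e \in T, spans_connected & acyclic].

End Trees.

Definition connected_graph (X : finite_graph) : Prop :=
  spans_connected [set: edge X]%SET.

Record graph_of_groups (X : finite_graph) := GraphOfGroups {
  vgroup : vertex X -> groupType;
  egroup : edge X -> groupType;
  egroup_bar : forall e, egroup (bar e) = egroup e;
  emb : forall e, {multiplicative egroup e -> vgroup (src e)};
  emb_inj : forall e, injective (emb e) }.

Section FundamentalGroup.
Variables (X : finite_graph) (G : graph_of_groups X) (T : {set edge X}).

(* Transport of g along egroup (bar e) = egroup e; it is the identity of the
   common edge group. *)
Definition to_bar (e : edge X) (g : egroup G e) : egroup G (bar e) :=
  ecast H (H : groupType) (esym (egroup_bar G e)) g.

(* None indexes the free factor, in which e and bar e are unrelated generators;
   RelBar below makes them inverse to each other. *)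
Definition pi1_factor (o : option (vertex X)) : groupType :=
  if o is Some v then vgroup G v else free_group (edge X).

Definition pi1_free : groupType := free_product pi1_factor.

Definition pi1_v (v : vertex X) (x : vgroup G v) : pi1_free :=
  @fprod_in _ pi1_factor (Some v) x.

Definition pi1_e (e : edge X) : pi1_free :=
  @fprod_in _ pi1_factor None (free_gen e).

Inductive pi1_relator : set pi1_free :=
| RelBar e : pi1_relator (pi1_e e * pi1_e (bar e))
| RelTree t of t \in T : pi1_relator (pi1_e t)
| RelEdge e (g : egroup G e) :
    pi1_relator ((pi1_e e)^-1 * pi1_v (emb G e g) * pi1_e e
                 * (pi1_v (emb G (bar e) (to_bar g)))^-1).

Definition pi1 : groupType := quot_by pi1_relator.

End FundamentalGroup.

(* Main.v *)
From HB Require Import structures.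
Require Import Defs.
From mathcomp Require Import all_boot fingroup perm.
From mathcomp Require Import ssralg ssrnum ssrint intdiv zify.
From mathcomp Require Import boolp classical_sets functions cardinality.

(** Let H be the union of an ascending chain of subgroups, each generated by at
    most M elements.  The chain is stationary as soon as H is finitely generated,
    and the chain limits the homomorphisms from H to Z/2: if phi_1, ..., phi_n and
    h_1, ..., h_n in H satisfy phi_i(h_j) = delta_ij, then all the h_j lie in one
    term of the chain, on which the 2^n distinct sums of the phi_i are determined
    by M values, so n <= M ([chain_dual_bound]).  It is therefore enough to show
    that a subgroup H of the fundamental group which is not finitely generated has
    arbitrarily large dual families.

    This can fail because of torsion, so H is first replaced by its intersection
    with a normal subgroup of finite index.  A virtually polycyclic group has a
    normal subgroup of finite index that is poly-Z
    ([virtually_polycyclic_normal_polyZ]); being torsion-free, it meets the edge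
    groups trivially.  The finite quotients of the vertex groups act freely on one
    common finite set ([common_coset_action]).  The two actions of an edge group on
    that set are free, hence conjugate, and conjugating permutations are images for
    the stable letters.  This gives a map onto a finite group whose kernel meets
    the conjugates of vertex groups in poly-Z groups and those of edge groups
    trivially ([finite_quotient]).  The bound on the rank survives by Schreier's
    argument ([kernel_generated]).

    For such an H, consider the graph with vertices the double cosets H p G_v and
    edges the double cosets H p G_e.  A homomorphism from H to Z/2 is the
    restriction of a cocycle c(p, x), with p and x in the whole group, that is
    H-invariant in p; since the group is defined by a presentation, a cocycle can
    be prescribed on generators ([extend_cocycle]).  The edge groups act freely on
    the cosets of H, so that cocycles of the vertex groups can be prescribed
    arbitrarily ([extend_vertex_cocycle]), and so can functions on the edges of the
    graph ([extend_edge_cocycle]).  A nontrivial poly-Z group maps onto Z/2, so a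
    dual family detects every vertex with nontrivial stabiliser and every edge
    outside a breadth-first spanning tree: there are finitely many of both
    ([nontrivial_node_finite], [nontree_edge_finite]).  The finitely generated
    stabilisers and the loops through the non-tree edges generate H
    ([subgroup_fin_gen]).

    The tree relators are removed beforehand: as the edges of a tree carry no
    holonomy ([tree_potential]), the fundamental group is a retract of the group in
    which the tree edges are free stable letters ([pi1_embedding]). *)

Set Implicit Arguments.
Unset Strict Implicit.
Unset Printing Implicit Defensive.

Local Open Scope classical_set_scope.
Local Open Scope group_scope.

(** * Subgroups, generation and chains of bounded rank *)

Section Subgroups.
Variable G : groupType.
Implicit Types (H K X : set G) (s : seq G).

Lemma subgroupP H :
  subgroup H <-> H 1 /\ forall x y, H x -> H y -> H (x * y^-1).
Proof.
split=> [[/set_mem H1 HF]|[H1 HF]].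
  split=> // x y Hx Hy; apply/set_mem/HF; exact/mem_set.
by split=> [|x y /set_mem Hx /set_mem Hy]; apply/mem_set => //; apply: HF.
Qed.

Lemma subgroup1 H : subgroup H -> H 1.
Proof. by case/subgroupP. Qed.

Lemma subgroupV H x : subgroup H -> H x -> H x^-1.
Proof. by case/subgroupP=> H1 HF Hx; rewrite -div1g; apply: HF. Qed.

Lemma subgroupM H x y : subgroup H -> H x -> H y -> H (x * y).
Proof.
move=> sgH Hx Hy; rewrite -[y]invgK; case/subgroupP: (sgH) => _; apply=> //.
exact: subgroupV.
Qed.

Lemma subgroupVE H x : subgroup H -> H x^-1 = H x.
Proof.
move=> sgH; apply/propext; split=> /(subgroupV sgH) //; by rewrite invgK.
Qed.

Lemma subgroupX H x n : subgroup H -> H x -> H (x ^+ n).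
Proof.
move=> sgH Hx; elim: n => [|n IHn]; first exact: subgroup1.
by rewrite expgS; apply: subgroupM.
Qed.

Lemma subgroupMl H x y : subgroup H -> H x -> H (x * y) = H y.
Proof.
move=> sgH Hx; apply/propext; split=> Hy; last exact: subgroupM.
by rewrite -[y](mulKg x); apply: subgroupM => //; apply: subgroupV.
Qed.

Lemma subgroupMr H x y : subgroup H -> H y -> H (x * y) = H x.
Proof.
move=> sgH Hy; apply/propext; split=> Hx; last exact: subgroupM.
by rewrite -[x](mulgK y); apply: subgroupM => //; apply: subgroupV.
Qed.

Lemma subgroup_intro H : H 1 -> (forall x y, H x -> H y -> H (x * y)) ->
  (forall x, H x -> H x^-1) -> subgroup H.
Proof. by move=> H1 HM HV; apply/subgroupP; split=> // x y Hx /HV; apply: HM. Qed.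

Lemma subgroupI H K : subgroup H -> subgroup K -> subgroup (H `&` K).
Proof.
move=> sH sK; apply: subgroup_intro; first by split; apply: subgroup1.
  by move=> x y [Hx Kx] [Hy Ky]; split; apply: subgroupM.
by move=> x [Hx Kx]; split; apply: subgroupV.
Qed.

Lemma gen_subgroupP X : subgroup (gen_subgroup X).
Proof.
apply: subgroup_intro => [A [/subgroup1] //|x y gx gy A [sA XA]|x gx A [sA XA]].
  by apply: subgroupM => //; [apply: gx | apply: gy].
by apply: subgroupV => //; apply: gx.
Qed.

Lemma gen_subgroup_sub X : X `<=` gen_subgroup X.
Proof. by move=> x Xx A [_]; apply. Qed.

Lemma gen_subgroup_min X K :
  subgroup K -> X `<=` K -> gen_subgroup X `<=` K.
Proof. by move=> sK XK x; apply. Qed.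

Lemma gen_subgroupS X Y : X `<=` Y -> gen_subgroup X `<=` gen_subgroup Y.
Proof.
move=> XY; apply: gen_subgroup_min; first exact: gen_subgroupP.
by move=> x /XY; apply: gen_subgroup_sub.
Qed.

Definition generated_by H s := H = gen_subgroup [set` s].

Lemma generated_by_intro H s : subgroup H -> [set` s] `<=` H ->
  H `<=` gen_subgroup [set` s] -> generated_by H s.
Proof.
by move=> sH sub1 sub2; apply/seteqP; split=> //; apply: gen_subgroup_min.
Qed.

Lemma generated_by_sub H s : generated_by H s -> [set` s] `<=` H.
Proof. by move->; apply: gen_subgroup_sub. Qed.

Lemma generated_by_subgroup H s : generated_by H s -> subgroup H.
Proof. by move->; apply: gen_subgroupP. Qed.

Lemma fin_genP H : fin_gen H <-> exists s, generated_by H s.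
Proof.
split=> [[X /finite_seqP [s ->] ->]|[s ->]]; first by exists s.
by exists [set` s] => //; apply: finite_seq.
Qed.

Lemma rk_generated H M : fin_gen H -> (rk H <= M)%N ->
  exists2 s, (size s <= M)%N & generated_by H s.
Proof.
move=> fgH; rewrite /rk; case: pselect => [ex_n|]; last first.
  case; case: fgH => X /finite_setP [n Xn] HX; exists n; apply/asboolP.
  by exists X.
case: ex_minnP => n /asboolP [X Xn HX] _ le_nM.
have [f [fX f_inj f_surj]] := (card_set_bijP (A := X) (B := `I_n) Xn).
pose g i := xget 1 [set x | X x /\ f x = i].
have gP i : (i < n)%N -> X (g i).
  move=> lt_in; have [x Xx fx] := f_surj i lt_in.
  by have [] : [set x | X x /\ f x = i] (g i) by apply: xgetPex; exists x.
exists [seq g i | i <- iota 0 n]; first by rewrite size_map size_iota.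
rewrite /generated_by HX; congr gen_subgroup; apply/seteqP.
split=> x /= => [Xx|/mapP [i]]; last by rewrite mem_iota => /andP [_ /gP] ? ->.
apply/mapP; exists (f x); first by rewrite mem_iota; apply: fX.
have [Xg fg] : [set y | X y /\ f y = f x] (g (f x)) by apply: (@xgetI _ _ _ x).
by apply: f_inj; rewrite ?fg //; apply: mem_set.
Qed.

End Subgroups.

(** The chains that the Takahasi property is about, with the rank bound turned
    into explicit generating sequences. *)
Definition bounded_chain (G : groupType) (M : nat) (H : nat -> set G) : Prop :=
  (forall j, exists2 s, (size s <= M)%N & generated_by (H j) s) /\
  (forall j, H j `<=` H j.+1).

Section Chains.
Variables (G : groupType) (M : nat) (H : nat -> set G).
Hypothesis chainH : bounded_chain M H.

Lemma chain_subgroup j : subgroup (H j).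
Proof. by case: chainH => + _ => /(_ j) [s _ /generated_by_subgroup]. Qed.

Lemma chain_le i j : (i <= j)%N -> H i `<=` H j.
Proof.
move=> /subnK <-; elim: (j - i)%N => [//|n IHn] x /IHn.
by rewrite addSn; apply: chainH.2.
Qed.

Lemma chain_seq (s : seq G) : [set` s] `<=` \bigcup_j H j ->
  exists j, [set` s] `<=` H j.
Proof.
elim: s => [|x s IHs] sub; first by exists 0%N.
have [|j sj] := IHs; first by move=> y ys; apply: sub; rewrite /= inE ys orbT.
have [i _ xi] : (\bigcup_j H j) x by apply: sub; rewrite /= mem_head.
exists (maxn i j) => y; rewrite /= inE => /predU1P [->|/sj].
  by apply: chain_le xi; apply: leq_maxl.
by apply: chain_le; apply: leq_maxr.
Qed.

Lemma chain_union_subgroup : subgroup (\bigcup_j H j).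
Proof.
apply: subgroup_intro; first by exists 0%N => //; apply: subgroup1 (chain_subgroup 0).
  move=> x y [i _ Hx] [j _ Hy]; exists (maxn i j) => //.
  apply: subgroupM; first exact: chain_subgroup.
    by apply: chain_le Hx; apply: leq_maxl.
  by apply: chain_le Hy; apply: leq_maxr.
by move=> x [i _ Hx]; exists i => //; apply: subgroupV => //; apply: chain_subgroup.
Qed.

Lemma chain_stationary : fin_gen (\bigcup_j H j) ->
  exists n, forall j, (n <= j)%N -> H j = H n.
Proof.
case/fin_genP=> s defU; have [n sn] := chain_seq (generated_by_sub defU).
exists n => j le_nj; apply/seteqP; split; last by apply: chain_le.
move=> x Hx; have : (\bigcup_j H j) x by exists j.
rewrite [X in X x -> _]defU; apply: (gen_subgroup_min _ sn).
exact: chain_subgroup.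
Qed.

End Chains.

Lemma takahasi_criterion (G : groupType) :
  (forall M (H : nat -> set G), bounded_chain M H -> fin_gen (\bigcup_j H j)) ->
  takahasi G.
Proof.
move=> fgU H sgfgH incH [M rkH]; apply: (@chain_stationary _ M); last first.
  apply: (fgU M); split=> // j; apply: rk_generated => //; apply: (sgfgH j).2.
by split=> // j; apply: rk_generated => //; apply: (sgfgH j).2.
Qed.

(** * Homomorphisms to Z/2 and dual families *)

(** Greedily extending a duplicate-free sequence in Q must stop. *)
Lemma finite_of_bounded (T : choiceType) (Q : set T) M :
    (forall s : seq T, uniq s -> [set` s] `<=` Q -> (size s <= M)%N) ->
  exists s : seq T, Q = [set` s].
Proof.
move=> bound; apply: contrapT => infQ.
suff [s [us sQ ss]] : exists s : seq T, [/\ uniq s, [set` s] `<=` Q & size s = M.+1].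
  by move: (bound s us sQ); rewrite ss ltnn.
elim: M.+1 => [|n [s [us sQ <-]]]; first by exists [::].
suff [x Qx xs] : exists2 x, Q x & x \notin s.
  exists (x :: s); split=> //=; first by rewrite xs.
  by move=> y /=; rewrite inE => /predU1P [->|/sQ].
apply: contrapT => nx; apply: infQ; exists s; apply/seteqP; split=> // x Qx.
by apply/negPn/negP => xs; apply: nx; exists x.
Qed.

(** Homomorphisms from H to Z/2, written as [bool] with exclusive or; phi is a map
    on G, so that H need not be made into a type. *)
Definition additive_on (G : groupType) (H : set G) (phi : G -> bool) : Prop :=
  forall x y, H x -> H y -> phi (x * y) = phi x (+) phi y.

Section AdditiveOn.
Variables (G : groupType) (H : set G).
Hypothesis sgH : subgroup H.

Lemma additive1 phi : additive_on H phi -> phi 1 = false.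
Proof.
move=> add; have H1 := subgroup1 sgH.
by have := add 1 1 H1 H1; rewrite mulg1; case: (phi 1).
Qed.

Lemma additiveV phi x : additive_on H phi -> H x -> phi x^-1 = phi x.
Proof.
move=> add Hx; have := add _ _ Hx (subgroupV sgH Hx).
by rewrite mulgV (additive1 add); case: (phi x); case: (phi _).
Qed.

Lemma additiveJ phi x y : additive_on H phi -> H x -> H y ->
  phi (x * y * x^-1) = phi y.
Proof.
move=> add Hx Hy; rewrite !add ?additiveV //; first by rewrite addbC addKb.
  exact: subgroupM.
exact: subgroupV.
Qed.

Lemma additive_agree phi psi : additive_on H phi -> additive_on H psi ->
  subgroup (H `&` [set x | phi x = psi x]).
Proof.
move=> addf addg; apply: subgroup_intro => [|x y [Hx ex] [Hy ey]|x [Hx ex]].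
- by split; [apply: subgroup1|rewrite /= !additive1].
- by split; [apply: subgroupM|rewrite /= addf // addg // ex ey].
- by split; [apply: subgroupV|rewrite /= !additiveV].
Qed.

End AdditiveOn.

(** Every family of homomorphisms from H to Z/2 having a dual family of elements
    has size at most M, that is, Hom(H, Z/2) has dimension at most M. *)
Definition dual_bound (G : groupType) (H : set G) (M : nat) : Prop :=
  forall n (phi : 'I_n -> G -> bool) (h : 'I_n -> G),
    (forall i, H (h i)) -> (forall i, additive_on H (phi i)) ->
    (forall i j, phi i (h j) = (i == j)) -> (n <= M)%N.

(** A large enough term of the chain contains the dual elements, so the 2^n sums of
    the phi_i remain distinct on that term; but they are determined by their values
    on its M generators. *)
Lemma chain_dual_bound (G : groupType) M (H : nat -> set G) :
  bounded_chain M H -> dual_bound (\bigcup_j H j) M.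
Proof.
move=> chH n phi h Uh addphi dual; set U := \bigcup_j H j in Uh addphi *.
have sgU : subgroup U := chain_union_subgroup chH.
have [|k hk] := @chain_seq _ _ _ chH [seq h i | i <- enum 'I_n].
  by move=> _ /mapP [i _ ->]; apply: Uh.
have {}hk i : H k (h i) by apply: hk; rewrite /= map_f // mem_enum.
have [s les defs] := chH.1 k.
have sgk := chain_subgroup chH k.
have subU : H k `<=` U by move=> x Hx; exists k.
pose sumphi (A : {set 'I_n}) x := \big[addb/false]_(i in A) phi i x.
have addsum A : additive_on (H k) (sumphi A).
  move=> x y Hx Hy; rewrite /sumphi -big_split /=; apply: eq_bigr => i _.
  by apply: addphi; apply: subU.
have sumphi_h A j : sumphi A (h j) = (j \in A).
  rewrite /sumphi; case: (boolP (j \in A)) => [jA|jA].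
    rewrite (bigD1 j) //= dual eqxx big1 // => i /andP [_ /negPf nij].
    by rewrite dual nij.
  by rewrite big1 // => i iA; rewrite dual; case: eqP iA jA => // -> ->.
pose values A : {ffun 'I_M -> bool} := [ffun l : 'I_M => sumphi A (nth 1 s l)].
suff /leq_card : injective values.
  by rewrite card_ffun card_bool !card_ord -cardsT -powersetT card_powerset
             cardsT card_ord leq_exp2l.
move=> A B eqAB; apply/setP => j; rewrite -!sumphi_h.
have sgE := additive_agree sgk (addsum A) (addsum B).
suff : H k `<=` H k `&` [set x | sumphi A x = sumphi B x] by case/(_ _ (hk j)).
rewrite {1}defs; apply: gen_subgroup_min => // x xs; split.
  exact: generated_by_sub defs _ xs.
have lt_xM : (index x s < M)%N by apply: leq_trans les; rewrite index_mem.
by have := congr1 (fun f : {ffun _} => f (Ordinal lt_xM)) eqAB; rewrite !ffunE /= nth_index.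
Qed.

(** * Kernels of maps to finite groups *)

Definition kernel (G K : groupType) (f : G -> K) : set G := [set x | f x = 1].

Definition hom (G K : groupType) (f : G -> K) : Prop := {morph f : x y / x * y}.

Section Hom.
Variables (G K : groupType) (f : G -> K).
Hypothesis homf : hom f.

Lemma hom1 : f 1 = 1.
Proof. by apply: (@mulgI _ (f 1)); rewrite -homf !mulg1. Qed.

Lemma homV x : f x^-1 = (f x)^-1.
Proof. by apply: (@mulgI _ (f x)); rewrite -homf !mulgV hom1. Qed.

Lemma kernel_subgroup : subgroup (kernel f).
Proof.
apply: subgroup_intro => [|x y|x]; rewrite /kernel /=; first exact: hom1.
  by move=> fx fy; rewrite homf fx fy mulg1.
by move=> fx; rewrite homV fx invg1.
Qed.

End Hom.

Section FiniteImage.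
Variables (G : groupType) (gT : finGroupType) (rho : G -> gT).
Variable H : set G.
Hypotheses (homr : hom rho) (sgH : subgroup H).

(** Transversal of the kernel; the value 1 at d = 1 makes Schreier's argument end
    in the kernel itself and not in a conjugate. *)
Let lifts (d : gT) : bool := `[< exists2 x, H x & rho x = d >].
Let lift (d : gT) : G := if d == 1 then 1 else xget 1 [set x | H x /\ rho x = d].

Let liftP d : lifts d -> H (lift d) /\ rho (lift d) = d.
Proof.
rewrite /lift; case: eqP => [-> _|_ /asboolP [x Hx <-]].
  by split; [apply: subgroup1|rewrite (hom1 homr)].
suff : [set y | H y /\ rho y = rho x] (xget 1 [set y | H y /\ rho y = rho x]) by [].
by apply: (@xgetI _ _ _ x).
Qed.

Let lifts_rho x : H x -> lifts (rho x).
Proof. by move=> Hx; apply/asboolP; exists x. Qed.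

Let liftsM d x : lifts d -> H x -> lifts (d * rho x).
Proof.
move=> /asboolP [y Hy <-] Hx; rewrite -homr; apply: lifts_rho.
exact: subgroupM.
Qed.

Let liftsV d x : lifts d -> H x -> lifts (d * (rho x)^-1).
Proof. by rewrite -(homV homr) => ld Hx; apply: liftsM => //; apply: subgroupV. Qed.

(** Schreier's generators lift d * x * (lift (d * rho x))^-1 of the kernel. *)
Lemma kernel_generated s : generated_by H s ->
  exists2 t, (size t <= #|gT| * size s)%N & generated_by (H `&` kernel rho) t.
Proof.
move=> defs; have sH := generated_by_sub defs.
pose t := [seq lift d * x * (lift (d * rho x))^-1 | d <- enum lifts, x <- s].
exists t; first by rewrite size_allpairs leq_mul2r -cardE max_card orbT.
have sgK := kernel_subgroup homr.
apply: generated_by_intro; first exact: subgroupI.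
  move=> _ /= /allpairsP [[d x] /= [+ xs ->]]; rewrite mem_enum => ld.
  have Hx := sH _ xs; have [Hd rd] := liftP ld.
  have [Hd' rd'] := liftP (liftsM ld Hx).
  split; last by rewrite /kernel /= !homr (homV homr) rd rd' mulgV.
  by apply: subgroupM; rewrite ?subgroupVE //; apply: subgroupM.
set L := gen_subgroup _; have sgL : subgroup L by apply: gen_subgroupP.
(* The Schreier cocycle stays in L along products, hence on all of H. *)
pose A := H `&` [set h | forall d, lifts d -> L (lift d * h * (lift (d * rho h))^-1)].
have sgA : subgroup A.
  apply: subgroup_intro => [|x y [Hx Ax] [Hy Ay]|x [Hx Ax]].
  - split=> [|d _]; first exact: subgroup1.
    by rewrite (hom1 homr) !mulg1 mulgV; apply: subgroup1.
  - split=> [|d ld]; first exact: subgroupM.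
    have := subgroupM sgL (Ax _ ld) (Ay _ (liftsM ld Hx)).
    by rewrite !mulgA mulgVK homr !mulgA.
  - split=> [|d ld]; first exact: subgroupV.
    have := Ax _ (liftsV ld Hx); rewrite mulgVK -(subgroupVE _ sgL).
    by rewrite !invgM invgK (homV homr) mulgA.
have HA : H `<=` A.
  rewrite [X in X `<=` _]defs; apply: gen_subgroup_min => // x xs.
  split=> [|d ld]; first exact: sH.
  apply: gen_subgroup_sub; apply/allpairsP; exists (d, x); split=> //.
  by rewrite mem_enum.
move=> x [Hx kx]; have l1 : lifts 1.
  by rewrite -(hom1 homr); apply: lifts_rho; apply: subgroup1.
by have [_ /(_ 1 l1)] := HA _ Hx; rewrite kx mulg1 /lift eqxx mul1g invg1 mulg1.
Qed.

Lemma fin_gen_of_kernel : fin_gen (H `&` kernel rho) -> fin_gen H.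
Proof.
case/fin_genP=> s defs; apply/fin_genP.
exists (s ++ [seq lift d | d <- enum lifts]); apply: generated_by_intro => //.
  move=> x /=; rewrite mem_cat => /orP [/(generated_by_sub defs) [] //|].
  by case/mapP=> d; rewrite mem_enum => /liftP [Hd _] ->.
move=> x Hx; set L := gen_subgroup _; have sgL : subgroup L by apply: gen_subgroupP.
have [Hl rl] := liftP (lifts_rho Hx).
rewrite -[x](mulgVK (lift (rho x))); apply: (subgroupM sgL); last first.
  apply: gen_subgroup_sub; rewrite /= mem_cat map_f ?orbT // mem_enum.
  exact: lifts_rho.
have : (H `&` kernel rho) (x * (lift (rho x))^-1).
  split; first by apply: subgroupM; rewrite ?subgroupVE.
  by rewrite /kernel /= homr (homV homr) rl mulgV.
by rewrite defs; apply: gen_subgroupS => y; rewrite /= mem_cat => ->.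
Qed.

End FiniteImage.

(** * Poly-Z groups *)

Section IntegerPowers.
Variable G : groupType.
Implicit Types (g x : G) (z : int).

Definition zexp g z : G :=
  match z with Posz n => g ^+ n | Negz n => g ^- n.+1 end.

Lemma zexpS g z : zexp g (z + 1)%R = zexp g z * g.
Proof.
case: z => n; first by rewrite (_ : (Posz n + 1)%R = Posz n.+1) /= ?expgSr //; lia.
case: n => [|n]; first by rewrite (_ : (Negz 0 + 1)%R = Posz 0) /= ?mulVg //; lia.
rewrite (_ : (Negz n.+1 + 1)%R = Negz n); last by lia.
by rewrite /= [in RHS]expgS invgM mulgVK.
Qed.

Lemma zexpP g z : zexp g (z - 1)%R = zexp g z * g^-1.
Proof. by rewrite -{2}[z](GRing.subrK 1%R) zexpS mulgK. Qed.

Lemma zexpD g a b : zexp g (a + b)%R = zexp g a * zexp g b.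
Proof.
elim/int_ind: b => [|n IHn|n IHn]; first by rewrite GRing.addr0 mulg1.
  rewrite (_ : (Posz n.+1 = n%:Z + 1)%R); last by lia.
  by rewrite GRing.addrA !zexpS IHn mulgA.
rewrite (_ : (- n.+1%:Z = - n%:Z - 1)%R); last by lia.
by rewrite GRing.addrA !zexpP IHn mulgA.
Qed.

Lemma zexpN g a : zexp g (- a)%R = (zexp g a)^-1.
Proof. by apply/esym/mulg1_eq; rewrite -zexpD GRing.subrr. Qed.

Lemma zexpB g a b : zexp g (a - b)%R = zexp g a * (zexp g b)^-1.
Proof. by rewrite zexpD zexpN. Qed.

Lemma zexpM g (m : nat) q : zexp g (m%:Z * q)%R = zexp (g ^+ m) q.
Proof.
elim/int_ind: q => [|n IHn|n IHn]; first by rewrite GRing.mulr0.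
  rewrite (_ : (Posz n.+1 = n%:Z + 1)%R); last by lia.
  by rewrite zexpS GRing.mulrDr GRing.mulr1 zexpD IHn.
rewrite (_ : (- n.+1%:Z = - n%:Z - 1)%R); last by lia.
by rewrite zexpP GRing.mulrBr GRing.mulr1 zexpB IHn.
Qed.

Lemma subgroup_zexp (H : set G) g z : subgroup H -> H g -> H (zexp g z).
Proof.
move=> sgH Hg; case: z => n /=; first exact: subgroupX.
by apply: subgroupV => //; apply: subgroupX.
Qed.

End IntegerPowers.

Section PolyZ.
Variable G : groupType.
Implicit Types (N S P Q : set G) (theta : G -> int).

Definition zhom_on N theta : Prop :=
  forall x y, N x -> N y -> theta (x * y) = (theta x + theta y)%R.

(** A map theta may vanish on N: the factors of the series are Z or trivial, so
    that subgroups inherit the series without reindexing. *)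
Inductive polyZ : set G -> Prop :=
| PolyZ1 : polyZ [set 1]
| PolyZS N theta of subgroup N & zhom_on N theta &
    polyZ (N `&` [set x | theta x = 0%R]) : polyZ N.

Lemma trivial_subgroup : subgroup [set (1 : G)].
Proof.
by apply: subgroup_intro => // [x y -> ->|x ->] /=; rewrite ?mulg1 ?invg1.
Qed.

Lemma polyZ_subgroup N : polyZ N -> subgroup N.
Proof. by case=> // *; apply: trivial_subgroup. Qed.

Lemma zhom1 N theta : subgroup N -> zhom_on N theta -> theta 1 = 0%R.
Proof.
move=> sgN homN; have N1 := subgroup1 sgN.
by have := homN _ _ N1 N1; rewrite mulg1; lia.
Qed.

Lemma zhomV N theta x : subgroup N -> zhom_on N theta -> N x ->
  theta x^-1 = (- theta x)%R.
Proof.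
move=> sgN homN Nx; have := homN _ _ Nx (subgroupV sgN Nx).
by rewrite mulgV (zhom1 sgN homN); lia.
Qed.

Lemma zhomX N theta x z : subgroup N -> zhom_on N theta -> N x ->
  theta (zexp x z) = (z * theta x)%R.
Proof.
move=> sgN homN Nx; have NX w := subgroup_zexp w sgN Nx.
elim/int_ind: z => [|n IHn|n IHn]; first by rewrite (zhom1 sgN homN) GRing.mul0r.
  rewrite (_ : (Posz n.+1 = n%:Z + 1)%R); last by lia.
  by rewrite zexpS homN // IHn; lia.
rewrite (_ : (- n.+1%:Z = - n%:Z - 1)%R); last by lia.
by rewrite zexpP homN ?(zhomV sgN) ?IHn //; [lia|apply: subgroupV].
Qed.

Lemma zker_subgroup N theta : subgroup N -> zhom_on N theta ->
  subgroup (N `&` [set x | theta x = 0%R]).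
Proof.
move=> sgN homN; apply: subgroup_intro => [|x y [Nx x0] [Ny y0]|x [Nx x0]].
- by split; [apply: subgroup1|apply: zhom1 homN].
- by split; [apply: subgroupM|rewrite /= homN // x0 y0].
- by split; [apply: subgroupV|rewrite /= (zhomV sgN homN Nx) x0].
Qed.

Lemma polyZ_sub N S : polyZ N -> subgroup S -> S `<=` N -> polyZ S.
Proof.
move=> pN; elim: pN S => {N} [|N theta sgN homN _ IH] S sgS SN.
  suff -> : S = [set 1] by apply: PolyZ1.
  by apply/seteqP; split=> // x ->; apply: subgroup1.
have homS : zhom_on S theta by move=> x y /SN Nx /SN; apply: homN.
apply: (PolyZS sgS homS); apply: IH; first exact: zker_subgroup.
by move=> x [/SN].
Qed.

(** The image of a homomorphism to the integers is generated by its least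
    positive value. *)
Lemma zhom_generator N theta : subgroup N -> zhom_on N theta ->
    (exists2 x, N x & theta x <> 0%R) ->
  exists g, [/\ N g, (0 < theta g)%R &
    forall x, N x -> exists q, theta x = (q * theta g)%R].
Proof.
move=> sgN homN [x0 Nx0 nz0].
have ex_d : exists d, `[< (0 < d)%N /\ exists2 x, N x & theta x = Posz d >].
  exists (absz (theta x0)); apply/asboolP; split; first by lia.
  have [ge|lt] := Num.Theory.lerP 0%R (theta x0); first by exists x0 => //; lia.
  by exists x0^-1; [apply: subgroupV|rewrite (zhomV sgN homN Nx0); lia].
case: (ex_minnP ex_d) => d /asboolP [d_gt0 [g Ng gd]] min.
exists g; split=> //; first by lia.
move=> x Nx; exists (divz (theta x) (Posz d)); rewrite gd.
have := divz_eq (theta x) (Posz d); have := modz_ge0 (theta x) (d := Posz d).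
have := ltz_pmod (theta x) (d := Posz d).
set q := divz _ _; set r := modz _ _ => ltr ger eqx.
have {}ltr : (r < Posz d)%R by apply: ltr; lia.
have {}ger : (0 <= r)%R by apply: ger; lia.
suff r0 : r = 0%R by rewrite eqx r0; lia.
have [//|rnz] := eqVneq r 0%R.
have Ny : N (x * zexp g (- q)%R) by apply: subgroupM => //; apply: subgroup_zexp.
have ty : theta (x * zexp g (- q)%R) = r.
  by rewrite homN ?(zhomX _ sgN) //; [lia|apply: subgroup_zexp].
have : (d <= absz r)%N; last by lia.
apply: min; apply/asboolP; split; first by lia.
by exists (x * zexp g (- q)%R); rewrite ?ty //; lia.
Qed.

(** Elements of the kernel of theta, and one element with the least positive value. *)
Lemma polyZ_fin_gen N : polyZ N -> fin_gen N.
Proof.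
elim=> {N} [|N theta sgN homN pK fgK].
  apply/fin_genP; exists [::]; apply: generated_by_intro.
  - exact: trivial_subgroup.
  - by [].
  - by move=> x ->; apply: subgroup1 (gen_subgroupP _).
have [ex|nex] := pselect (exists2 x, N x & theta x <> 0%R); last first.
  suff eqN : N `&` [set x | theta x = 0%R] = N by rewrite eqN in fgK.
  apply/seteqP; split=> [x []//|x Nx]; split=> //=; apply: contrapT => xnz.
  by apply: nex; exists x.
have [g [Ng g_gt0 gen]] := zhom_generator sgN homN ex.
case/fin_genP: fgK => s defs; apply/fin_genP; exists (g :: s).
have sub_s : [set` s] `<=` N by move=> x /(generated_by_sub defs) [].
apply: generated_by_intro => //.
  by move=> x; rewrite /= inE => /predU1P [->|/sub_s].
move=> x Nx; have [q eqx] := gen x Nx; set L := gen_subgroup _.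
have sgL : subgroup L by apply: gen_subgroupP.
have Lg : L g by apply: gen_subgroup_sub; rewrite /= mem_head.
rewrite -[x](mulgVK (zexp g q)); apply: (subgroupM sgL); last exact: (subgroup_zexp q sgL Lg).
suff : (N `&` [set x | theta x = 0%R]) (x * (zexp g q)^-1).
  by rewrite defs; apply: gen_subgroupS => y; rewrite /= inE orbC => ->.
have Ngq := subgroup_zexp q sgN Ng.
split; first by apply: subgroupM => //; apply: subgroupV.
rewrite /= homN //; last exact: subgroupV.
by rewrite (zhomV sgN homN Ngq) (zhomX _ sgN homN Ng) eqx; lia.
Qed.

Lemma polyZ_torsion_free N x n : polyZ N -> N x -> x ^+ n.+1 = 1 -> x = 1.
Proof.
move=> pN; elim: pN x => {N} [//|N theta sgN homN pK IH] x Nx xn1.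
apply: IH => //; split=> //=.
have := zhomX (Posz n.+1) sgN homN Nx; rewrite /= xn1 (zhom1 sgN homN).
by move/esym/eqP; rewrite GRing.mulf_eq0 => /orP [//|/eqP].
Qed.

(** A nontrivial poly-Z group maps onto Z, hence onto Z/2. *)
Lemma polyZ_parity N x : polyZ N -> N x -> x <> 1 ->
  exists2 psi, additive_on N psi & exists2 y, N y & psi y = true.
Proof.
move=> pN; elim: pN x => {N} [x -> //|N theta sgN homN pK IH] x Nx x1.
have [ex|nex] := pselect (exists2 x, N x & theta x <> 0%R); last first.
  suff eqN : N `&` [set x | theta x = 0%R] = N by rewrite eqN in IH; apply: IH Nx x1.
  apply/seteqP; split=> [y []//|y Ny]; split=> //=; apply: contrapT => ynz.
  by apply: nex; exists y.
have [g [Ng g_gt0 gen]] := zhom_generator sgN homN ex.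
exists (fun y => odd (absz (divz (theta y) (theta g)))); last first.
  by exists g => //; rewrite divzz; case: eqP => //; lia.
move=> y z Ny Nz; have [a ya] := gen y Ny; have [b zb] := gen z Nz.
by rewrite homN // ya zb -GRing.mulrDl !mulzK; lia.
Qed.

End PolyZ.

(** * Virtually polycyclic groups are virtually poly-Z *)

Section Colourings.
Variable G : groupType.
Implicit Types (N P Q : set G).

(** N has finite index in P, witnessed by a map to a finite type that separates the
    cosets of N.  Not requiring the colour to be constant on cosets makes such maps
    easy to build. *)
Definition coloured P N : Prop :=
  exists (F : finType) (d : G -> F),
    forall x y, P x -> P y -> d x = d y -> N (x^-1 * y).

Lemma coloured_refl P : subgroup P -> coloured P P.
Proof.
move=> sgP; exists unit, (fun _ => tt) => x y Px Py _.
by apply: subgroupM => //; apply: subgroupV.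
Qed.

Lemma coloured_trans P Q N : subgroup P -> coloured P Q -> coloured Q N -> coloured P N.
Proof.
move=> sgP [F [d dQ]] [E [c cN]].
pose r f := xget 1 [set x | P x /\ d x = f].
have rP x : P x -> Q ((r (d x))^-1 * x).
  move=> Px; have : [set y | P y /\ d y = d x] (r (d x)) by apply: (@xgetI _ _ _ x).
  by case=> Pr dr; apply: dQ.
exists (F * E)%type, (fun x => (d x, c ((r (d x))^-1 * x))) => x y Px Py [eqd].
have Qx := rP x Px; have Qy := rP y Py; rewrite -eqd in Qy *.
by move=> /(cN _ _ Qx Qy); rewrite invgM invgK !mulgA mulgK.
Qed.

Lemma finite_index_coloured N : subgroup N -> finite_index N -> coloured [set: G] N.
Proof.
move=> sgN /finite_seqP [s cosets].
have in_s x : *%g x @` N \in s.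
  have : range (fun x : G => *%g x @` N) ( *%g x @` N) by exists x.
  by rewrite cosets.
exists 'I_(size s).+1, (fun x => inord (index ( *%g x @` N) s)) => x y _ _.
move=> /(congr1 val); rewrite /= !inordK ?ltnS ?index_size // => eqi.
have eqxy : *%g x @` N = *%g y @` N.
  by rewrite -[LHS](nth_index set0 (in_s x)) eqi nth_index.
have [h Nh <-] : ( *%g x @` N) y by rewrite eqxy; exists 1; [apply: subgroup1|rewrite mulg1].
by rewrite mulKg.
Qed.

(** Colouring x by the colour of a chosen representative of its coset. *)
Lemma coloured_exact N : subgroup N -> coloured [set: G] N ->
  exists (F : finType) (e : G -> F),
    (forall x y, e x = e y <-> N (x^-1 * y)) /\ forall f, exists x, e x = f.
Proof.
move=> sgN [F [d dN]]; pose r x := xget 1 [set y | N (x^-1 * y)].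
have rN x : N (x^-1 * r x).
  suff : [set y | N (x^-1 * y)] (r x) by [].
  by apply: xgetPex; exists x; rewrite /= mulVg; apply: subgroup1.
pose im f := `[< exists x, d (r x) = f >].
have imr x : im (d (r x)) by apply/asboolP; exists x.
exists {f : F | im f}, (fun x => exist (fun f : F => im f) (d (r x)) (imr x)); split=> [x y|[f imf]]; last first.
  by have /asboolP [x dx] := imf; exists x; apply: val_inj.
split=> [/(congr1 val) /= /dN Nr|Nxy].
  have := subgroupM sgN (subgroupM sgN (rN x) (Nr I I)) (subgroupV sgN (rN y)).
  by rewrite invgM invgK !mulgA !mulgK.
apply: val_inj => /=; congr d; congr xget; apply/seteqP; split=> z /= Nz.
  have := subgroupM sgN (subgroupV sgN Nxy) Nz.
  by rewrite invgM invgK !mulgA mulgK.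
by have := subgroupM sgN Nxy Nz; rewrite !mulgA mulgK.
Qed.

(** The conjugate of N by g depends only on the coset g N, so the core is a finite
    intersection. *)
Lemma coloured_core N : subgroup N -> coloured [set: G] N ->
  coloured [set: G] [set x | forall g, N (x ^ g)].
Proof.
move=> sgN [F [d dN]]; pose r f := xget 1 [set x | d x = f].
have rE g : N ((r (d g))^-1 * g).
  by apply: dN => //; have : [set x | d x = d g] (r (d g)) by apply: (@xgetI _ _ _ g).
exists {ffun F -> F}, (fun x => [ffun f => d (x ^ r f)]) => x y _ _ eqd g.
have := congr1 (fun f : {ffun _} => f (d g)) eqd; rewrite !ffunE => /dN.
rewrite -conjVg -conjMg => /(_ I I) Nr.
have := subgroupM sgN (subgroupM sgN (subgroupV sgN (rE g)) Nr) (rE g).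
by rewrite !conjgE invgM invgK !mulgA !mulgK.
Qed.

Lemma core_subgroup N : subgroup N -> subgroup [set x | forall g, N (x ^ g)].
Proof.
move=> sgN; apply: subgroup_intro => [g|x y Nx Ny g|x Nx g] /=.
- by rewrite conj1g; apply: subgroup1.
- by rewrite conjMg; apply: subgroupM.
- by rewrite conjVg; apply: subgroupV.
Qed.

(** The verbal subgroup generated by m-th powers: invariant under all automorphisms,
    which is how finite-index subgroups are made normal below. *)
Definition powers m P : set G := gen_subgroup [set x | exists2 y, P y & x = y ^+ m].

Lemma powers_sub m P : subgroup P -> powers m P `<=` P.
Proof. by move=> sgP; apply: gen_subgroup_min => // _ [y Py ->]; apply: subgroupX. Qed.

Lemma powersJ m P g x : (forall y, P y -> P (y ^ g)) -> powers m P x ->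
  powers m P (x ^ g).
Proof.
move=> PJ; have sgK := gen_subgroupP [set x | exists2 y, P y & x = y ^+ m].
suff : powers m P `<=` [set x | powers m P (x ^ g)] by apply.
apply: gen_subgroup_min => [|_ [y Py ->] /=].
  apply: subgroup_intro => [|a b|a] /=.
  - by rewrite conj1g; apply: subgroup1 sgK.
  - by rewrite conjMg; apply: subgroupM sgK.
  - by rewrite conjVg; apply: subgroupV sgK.
by apply: gen_subgroup_sub; exists (y ^ g); [apply: PJ|rewrite conjXg].
Qed.

(** A subgroup of finite index contains all powers with a suitable exponent:
    two of the first powers of x lie in the same coset. *)
Lemma coloured_powers P N : subgroup P -> subgroup N -> coloured P N ->
  exists2 m, (0 < m)%N & powers m P `<=` N.
Proof.
move=> sgP sgN [F [d dN]]; exists (#|F|)`!; first exact: fact_gt0.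
apply: gen_subgroup_min => // _ [y Py ->].
have : ~ injective (fun i : 'I_(#|F|).+1 => d (y ^+ i)).
  by move=> /leq_card; rewrite card_ord ltnn.
move=> ninj; have [i [j [lt_ij eqd]]] : exists i j : 'I_(#|F|).+1,
    (i < j)%N /\ d (y ^+ i) = d (y ^+ j).
  apply: contrapT => nex; apply: ninj => i j eqd; apply: val_inj.
  have [lt|lt|//] := ltngtP i j; case: nex; first by exists i, j.
  by exists j, i.
have := dN _ _ (subgroupX i sgP Py) (subgroupX j sgP Py) eqd.
rewrite -(subnKC (ltnW lt_ij)) expgnDr mulKg => Nk.
have /dvdnP [q ->] : (j - i %| (#|F|)`!)%N.
  by apply: dvdn_fact; rewrite subn_gt0 lt_ij (leq_trans (leq_subr _ _)) // -ltnS.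
by rewrite mulnC expgnA; apply: subgroupX.
Qed.

End Colourings.

Definition residue (m : nat) (z : int) : 'I_m.-1.+1 := inord (absz (modz z (Posz m))).

Lemma residueP m z w : (0 < m)%N -> residue m z = residue m w ->
  exists q, w = (z + Posz m * q)%R.
Proof.
move=> m_gt0 /(congr1 val); rewrite /= !inordK; try lia.
move=> eqm; exists (divz w (Posz m) - divz z (Posz m))%R.
have := divz_eq z (Posz m); have := divz_eq w (Posz m).
have : modz z (Posz m) = modz w (Posz m) by lia.
by move=> ->; lia.
Qed.

Lemma coset_split (G : groupType) (a c u w : G) :
  (a * u)^-1 * (a * c * w) = c ^ u * (u^-1 * w).
Proof. by rewrite conjgE invgM !mulgA mulgVK mulgK. Qed.

(** One step P / Q = <g Q> of a polycyclic series. *)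
Section CyclicStep.
Variables (G : groupType) (P Q : set G) (g : G).
Hypotheses (sgP : subgroup P) (sgQ : subgroup Q) (QP : Q `<=` P).
Hypotheses (normQ : normalises P Q) (Pg : P g).
Hypothesis cyc : forall x, P x -> exists z, Q ((zexp g z)^-1 * x).

Definition zlog x : int := xget 0%R [set z | Q ((zexp g z)^-1 * x)].

Lemma zlogP x : P x -> Q ((zexp g (zlog x))^-1 * x).
Proof.
move=> Px; suff : [set z | Q ((zexp g z)^-1 * x)] (zlog x) by [].
by apply: xgetPex; apply: cyc.
Qed.

Lemma norm_powers m x y : P x -> powers m Q y -> powers m Q (y ^ x).
Proof. by move=> Px; apply: powersJ => z; apply: normQ. Qed.

(** An element g^z u with u in Q is determined modulo m-th powers by z modulo m
    and by u modulo m-th powers of Q. *)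
Lemma coloured_powers_step m : (0 < m)%N ->
  coloured Q (powers m Q) -> coloured P (powers m P).
Proof.
move=> m_gt0 [F [d dK]].
have sgK' : subgroup (powers m P) by apply: gen_subgroupP.
exists ('I_m.-1.+1 * F)%type, (fun x => (residue m (zlog x), d ((zexp g (zlog x))^-1 * x))).
move=> x y Px Py [/(residueP m_gt0) [q eqy] /(dK _ _ (zlogP Px) (zlogP Py)) Kuv].
set u := _ * x in Kuv; set w := _ * y in Kuv; have Pu : P u by apply/QP/zlogP.
have {}Kuv : powers m P (u^-1 * w).
  by move: Kuv; apply: gen_subgroupS => _ [z Qz ->]; exists z => //; apply: QP.
have -> : x = zexp g (zlog x) * u by rewrite mulVKg.
have -> : y = zexp g (zlog x) * zexp (g ^+ m) q * w.
  by rewrite /w eqy zexpD zexpM mulVKg.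
rewrite coset_split; apply: (subgroupM sgK') => //; apply: powersJ => [z Pz|].
  by rewrite conjgE; apply: subgroupM; [|apply: subgroupV|apply: subgroupM].
by apply: (subgroup_zexp _ sgK'); apply: gen_subgroup_sub; exists g.
Qed.

Lemma coloured_torsion_step k : (0 < k)%N -> Q (g ^+ k) -> coloured P Q.
Proof.
move=> k_gt0 Qk; exists 'I_k.-1.+1, (fun x => residue k (zlog x)) => x y Px Py.
case/(residueP k_gt0) => q eqy; have Qu := zlogP Px; have Qw := zlogP Py.
set u := _ * x in Qu; set w := _ * y in Qw; have Pu := QP Qu.
have -> : x = zexp g (zlog x) * u by rewrite mulVKg.
have -> : y = zexp g (zlog x) * zexp (g ^+ k) q * w.
  by rewrite /w eqy zexpD zexpM mulVKg.
rewrite coset_split; apply: (subgroupM sgQ).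
  by apply: normQ => //; apply: subgroup_zexp.
by apply: (subgroupM sgQ) => //; apply: subgroupV.
Qed.

(** When g has infinite order modulo Q and K is a finite-index subgroup of Q
    normalised by P, the extension <g> K has finite index in P, and the exponent of
    g maps it onto Z with kernel K. *)
Section InfiniteOrder.
Variable K : set G.
Hypotheses (sgK : subgroup K) (KQ : K `<=` Q) (normK : normalises P K).
Hypothesis inf_order : forall k, (0 < k)%N -> ~ Q (g ^+ k).

Definition zext : set G := [set x | P x /\ exists z, K ((zexp g z)^-1 * x)].

Let ezlog x : int := xget 0%R [set z | K ((zexp g z)^-1 * x)].

Let Pexp z : P (zexp g z). Proof. exact: subgroup_zexp. Qed.

Let zexp_inj z w : Q (zexp g (z - w)%R) -> z = w.
Proof.
move=> Qzw; apply: contrapT => nzw.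
have : (0 < absz (z - w))%N by lia.
move/inf_order; apply; have [ge|lt] := Num.Theory.lerP 0%R (z - w)%R.
  by rewrite -[_ ^+ _]/(zexp g (absz (z - w))) (_ : Posz _ = (z - w)%R) //; lia.
have -> : g ^+ absz (z - w) = zexp g (- (z - w))%R.
  by rewrite -[LHS]/(zexp g (absz (z - w))); congr zexp; lia.
by rewrite zexpN; apply: subgroupV.
Qed.

Let ezlog_unique x z : K ((zexp g z)^-1 * x) -> ezlog x = z.
Proof.
move=> Kz; have Kw : K ((zexp g (ezlog x))^-1 * x).
  suff : [set z | K ((zexp g z)^-1 * x)] (ezlog x) by [].
  by apply: (@xgetI _ _ _ z).
apply/zexp_inj/KQ; have := subgroupM sgK Kz (subgroupV sgK Kw).
by rewrite invgM invgK mulgA mulgK GRing.addrC zexpD zexpN.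
Qed.

Let zextP x : zext x -> P x /\ K ((zexp g (ezlog x))^-1 * x).
Proof. by case=> Px [z Kz]; rewrite (ezlog_unique Kz). Qed.

Let zext_mul x y z w : P y -> K ((zexp g z)^-1 * x) -> K ((zexp g w)^-1 * y) ->
  K ((zexp g (z + w)%R)^-1 * (x * y)).
Proof.
move=> Py Kx Ky.
have -> : (zexp g (z + w)%R)^-1 * (x * y) =
    ((zexp g z)^-1 * x) ^ zexp g w * ((zexp g w)^-1 * y).
  by rewrite zexpD conjgE invgM !mulgA mulgK.
by apply: (subgroupM sgK) => //; apply: normK.
Qed.

Lemma zext_subgroup : subgroup zext.
Proof.
apply: subgroup_intro => [|x y [Px [z Kz]] [Py [w Kw]]|x [Px [z Kz]]].
- by split; [apply: subgroup1|exists 0%R; rewrite /= invg1 mulg1; apply: subgroup1].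
- by split; [apply: subgroupM|exists (z + w)%R; apply: zext_mul].
- split; first exact: subgroupV.
  exists (- z)%R; rewrite zexpN invgK.
  have -> : zexp g z * x^-1 = (((zexp g z)^-1 * x)^-1) ^ (zexp g z)^-1.
    by rewrite conjgE invgM !invgK !mulgA mulgK.
  by apply: normK; [apply: subgroupV|apply: subgroupV].
Qed.

Lemma zext_polyZ : polyZ K -> polyZ zext.
Proof.
move=> pK; apply: (PolyZS zext_subgroup (theta := ezlog)).
  move=> x y /zextP [Px Kx] /zextP [Py Ky]; apply: ezlog_unique.
  exact: zext_mul.
suff -> : zext `&` [set x | ezlog x = 0%R] = K by [].
apply/seteqP; split=> [x [/zextP [_ Kx] e0]|x Kx].
  by move: Kx; rewrite e0 /= invg1 mul1g.
have K0 : K ((zexp g 0%R)^-1 * x) by rewrite /= invg1 mul1g.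
split; last exact: ezlog_unique.
by split; [apply/QP/KQ|exists 0%R].
Qed.

Lemma coloured_zext : coloured Q K -> coloured P zext.
Proof.
(* The power of g is split off on the right here, so that elements u g^z and v g^w
   with u and v in the same coset of K differ by an element of <g> K. *)
case=> F [d dK]; exists F, (fun x => d (x * (zexp g (zlog x))^-1)) => x y Px Py.
have Qc z : P z -> Q (z * (zexp g (zlog z))^-1).
  move=> Pz; have -> : z * (zexp g (zlog z))^-1 =
      ((zexp g (zlog z))^-1 * z) ^ (zexp g (zlog z))^-1.
    by rewrite conjgE invgK !mulgA mulgV mul1g.
  by apply: normQ; [apply: subgroupV|apply: zlogP].
move/(dK _ _ (Qc _ Px) (Qc _ Py)) => Kxy; split.
  by apply: subgroupM => //; apply: subgroupV.
exists (zlog y - zlog x)%R.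
have -> : (zexp g (zlog y - zlog x)%R)^-1 * (x^-1 * y) =
    ((x * (zexp g (zlog x))^-1)^-1 * (y * (zexp g (zlog y))^-1)) ^ zexp g (zlog y).
  by rewrite GRing.addrC zexpD zexpN conjgE !invgM !invgK !mulgA mulgVK.
exact: normK.
Qed.

End InfiniteOrder.
End CyclicStep.

Definition virtually_polyZ (G : groupType) (P : set G) : Prop :=
  exists N, [/\ polyZ N, N `<=` P & coloured P N].

(** Induction along the series, together with the finite index of the subgroups of
    m-th powers.  If g has infinite order modulo Q, a poly-Z subgroup N of Q is
    replaced by the m-th powers of Q that it contains, which P normalises. *)
Lemma polycyclic_virtually_polyZ (G : groupType) (P : set G) :
  polycyclic P -> virtually_polyZ P.
Proof.
case=> n [H [<- Hn sgH step]].
(* The induction climbs the series from its trivial end. *)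
suff gen k : (k <= n)%N ->
    (forall m, (0 < m)%N -> coloured (H (n - k)%N) (powers m (H (n - k)%N))) /\
    virtually_polyZ (H (n - k)%N).
  by have [_] := gen n (leqnn n); rewrite subnn.
elim: k => [|k IHk] le_kn.
  rewrite subn0 Hn; have sg1 := trivial_subgroup G; split=> [m m_gt0|].
    exists unit, (fun _ => tt) => x y -> -> _; rewrite invg1 mulg1.
    exact: subgroup1 (gen_subgroupP _).
  by exists [set 1]; split; [apply: PolyZ1|by []|apply: coloured_refl].
have lt_i : (n - k.+1 < n)%N by lia.
have [] := step _ lt_i; have := sgH _ (ltnW lt_i); move: IHk.
have -> : (n - k = (n - k.+1).+1)%N by lia.
have sgQ : subgroup (H (n - k.+1).+1) by apply: sgH.
move: (H (n - k.+1)%N) (H (n - k.+1).+1) sgQ => {sgH step} P' Q sgQ IH sgP QP normQ [g Pg cyc].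
have {IH} [powQ [N [pN NQ colN]]] := IH (ltnW le_kn).
have {}cyc x : P' x -> exists z, Q ((zexp g z)^-1 * x).
  move=> /cyc [i [Qi|Qi]]; first by exists (Posz i).
  exists (- Posz i)%R; rewrite zexpN; exact: Qi.
split=> [m m_gt0|]; first exact: (coloured_powers_step sgP QP Pg cyc m_gt0 (powQ m m_gt0)).
have [[j [j_gt0 Qj]]|inf] := pselect (exists j, (0 < j)%N /\ Q (g ^+ j)).
  exists N; split=> //; first exact: subset_trans QP.
  apply: (coloured_trans sgP) colN.
  exact: (coloured_torsion_step sgQ QP normQ cyc j_gt0 Qj).
have [m m_gt0 powN] := coloured_powers sgQ (polyZ_subgroup pN) colN.
have sgK : subgroup (powers m Q) by apply: gen_subgroupP.
have KQ : powers m Q `<=` Q by apply: powers_sub.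
have pK : polyZ (powers m Q) := polyZ_sub pN sgK powN.
have normK : normalises P' (powers m Q) by move=> x y; apply: norm_powers.
have inf' j : (0 < j)%N -> ~ Q (g ^+ j) by move=> j_gt0 Qj; apply: inf; exists j.
exists (zext P' g (powers m Q)); split; last 1 first.
- exact: (coloured_zext sgP normQ Pg cyc normK (powQ m m_gt0)).
- exact: (zext_polyZ sgP sgQ QP Pg sgK KQ normK inf' pK).
- by move=> x [].
Qed.

Lemma virtually_polycyclic_normal_polyZ (G : groupType) :
  virtually_polycyclic G -> exists N : set G,
    [/\ polyZ N, normalises [set: G] N & coloured [set: G] N].
Proof.
case=> H [sgH finH /polycyclic_virtually_polyZ [N [pN NH colN]]].
have sgT : subgroup [set: G] by apply: subgroup_intro.
have sgN := polyZ_subgroup pN.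
have colG := coloured_trans sgT (finite_index_coloured sgH finH) colN.
exists [set x | forall g, N (x ^ g)]; split; last exact: coloured_core.
  by apply: (polyZ_sub pN (core_subgroup sgN)) => x /(_ 1); rewrite conjg1.
by move=> x y _ /= Ny g; rewrite -conjgM.
Qed.

(** * Free actions on finite sets *)

Definition free_action (A : groupType) (Om : finType) (j : A -> {perm Om}) : Prop :=
  forall g w, j g w = w -> g = 1.

Section FreeActions.
Variables (A : groupType) (B : finType) (b : B -> A) (Om : finType).
Hypothesis bij_b : bijective b.

(** A free action is a sum of copies of the regular action. *)
Lemma free_action_coordinates (j : A -> {perm Om}) : hom j -> free_action j ->
  exists (m : nat) (h : 'I_m * B -> Om), bijective h /\
    forall i x y g, b y = b x * g -> h (i, y) = j g (h (i, x)).
Proof.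
move=> homj free; pose rep w := xget w [set w' | exists g, w' = j g w].
have repP w : exists g, w = j g (rep w).
  have [g eqr] : [set w' | exists g, w' = j g w] (rep w).
    by apply: (@xgetI _ _ _ w); exists 1; rewrite (hom1 homj) perm1.
  by exists g^-1; rewrite eqr -permM -homj mulgV (hom1 homj) perm1.
have repJ g w : rep (j g w) = rep w.
  rewrite /rep (_ : [set w' | exists h, w' = j h (j g w)] = [set w' | exists g, w' = j g w]).
    rewrite /xget; case: pselect => // no; exfalso; apply: no.
    by exists (j g w); apply/asboolP; exists g.
  apply/seteqP; split=> _ [h ->]; first by exists (g * h); rewrite homj permM.
  by exists (g^-1 * h); rewrite homj permM -(permM (j g)) -homj mulgV (hom1 homj) perm1.
(* R contains one point of every orbit; its enumeration gives the coordinate in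
   'I_m, and the group element leading there from R the one in B. *)
pose R := [set w | rep w == w]%SET.
have repR w : rep w \in R.
  by rewrite finset.in_set; have [g eqw] := repP w; rewrite [in X in _ == X]eqw repJ eqxx.
exists #|R|, (fun ix => j (b ix.2) (enum_val ix.1)).
have [b' bK b'K] := bij_b; split; last first.
  by move=> i x y g /= ->; rewrite homj permM.
have injh : injective (fun ix : 'I_#|R| * B => j (b ix.2) (enum_val ix.1)).
  move=> [i x] [k y] /= eqh.
  have eqik : i = k.
    apply: enum_val_inj; have := congr1 rep eqh; rewrite !repJ.
    have := enum_valP i; rewrite finset.in_set => /eqP ->.
    by have := enum_valP k; rewrite finset.in_set => /eqP ->.
  subst k; congr pair; apply: (can_inj bK); apply/divg1_eq.
  apply: (free _ (enum_val i)); rewrite homj permM eqh -permM -homj mulgV.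
  by rewrite (hom1 homj) perm1.
have surj w : exists ix : 'I_#|R| * B, j (b ix.2) (enum_val ix.1) = w.
  have [g eqw] := repP w.
  by exists (enum_rank_in (repR w) (rep w), b' g); rewrite /= b'K enum_rankK_in.
pose inv w := sval (cid (surj w)).
have invK : cancel inv (fun ix => j (b ix.2) (enum_val ix.1)).
  by move=> w; apply: (svalP (cid (surj w))).
by exists inv => // ix; apply: injh; rewrite invK.
Qed.

(** Both actions have |Om| / |A| orbits. *)
Lemma free_actions_conjugate (j1 j2 : A -> {perm Om}) :
  hom j1 -> hom j2 -> free_action j1 -> free_action j2 ->
  exists t : {perm Om}, forall g, j1 g * t = t * j2 g.
Proof.
move=> hom1 hom2 free1 free2.
have [m1 [h1 [bij1 E1]]] := free_action_coordinates hom1 free1.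
have [m2 [h2 [bij2 E2]]] := free_action_coordinates hom2 free2.
have [b' bK b'K] := bij_b.
have eqm : m1 = m2.
  have B_gt0 : (0 < #|B|)%N by apply/card_gt0P; exists (b' 1).
  apply/eqP; rewrite -(eqn_pmul2r B_gt0) -(card_ord m1) -(card_ord m2) -!card_prod.
  by rewrite (bij_eq_card bij1) (bij_eq_card bij2).
subst m2; have [k1 h1K k1K] := bij1.
have inj_t : injective (h2 \o k1) by apply: inj_comp; [apply: bij_inj|apply: can_inj k1K].
exists (perm inj_t) => g; apply/permP => w; rewrite !permM !permE /=.
case eqk : (k1 w) => [i x].
have [y by_] : exists y, b y = b x * g by exists (b' (b x * g)).
rewrite -[w]k1K eqk -(E1 _ _ _ _ by_) h1K.
exact: E2.
Qed.

End FreeActions.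

Lemma finite_group_free_actions_conjugate (A : groupType) (Om : finType)
    (j1 j2 : A -> {perm Om}) :
  finite_set [set: A] ->
  hom j1 -> hom j2 -> free_action j1 -> free_action j2 ->
  exists t : {perm Om}, forall g, j1 g * t = t * j2 g.
Proof.
move=> /finite_seqP [s allA]; apply: (@free_actions_conjugate A (seq_sub s) (@ssval _ s)).
have in_s x : x \in s by have : [set: A] x by []; rewrite allA.
by exists (fun x => SeqSub (in_s x)) => // x; apply: val_inj.
Qed.

Section CosetAction.
Variables (V : finType) (Gv : V -> groupType) (N : forall v, set (Gv v)).
Hypothesis sgN : forall v, subgroup (@N v).
Hypothesis normN : forall v, normalises [set: Gv v] (@N v).
Hypothesis colN : forall v, coloured [set: Gv v] (@N v).

(** One finite set on which every G_v / N_v acts freely: the product of all these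
    quotients. *)
Lemma common_coset_action : exists (Om : finType) (rho : forall v, Gv v -> {perm Om}),
  [/\ (0 < #|Om|)%N, forall v, hom (@rho v) &
      forall v x w, rho v x w = w -> @N v x].
Proof.
have col v := cid (coloured_exact (sgN v) (colN v)).
pose F v : finType := sval (col v).
have colour_e v : {e : Gv v -> F v | (forall x y, e x = e y <-> @N v (x^-1 * y)) /\
    forall f, exists x, e x = f} by apply: cid; apply: (svalP (col v)).
pose e v := sval (colour_e v).
have eE v x y : e v x = e v y <-> @N v (x^-1 * y).
  by case: (svalP (colour_e v)) => + _; apply.
have e_surj v f : exists x, e v x = f.
  by case: (svalP (colour_e v)) => _; apply.
pose r v f := sval (cid (e_surj v f)).
have rK v f : e v (r v f) = f by apply: (svalP (cid (e_surj v f))).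
pose act v (x : Gv v) (f : F v) : F v := e v (r v f * x).
have actE v x y : act v x (e v y) = e v (y * x).
  apply/eE; rewrite invgM -mulgA (mulgA _ y) -conjgE -?mulgA.
  by apply: normN => //; apply/eE; rewrite rK.
pose Om : finType := {dffun forall v, F v}.
pose mv v (x : Gv v) (w : Om) : Om := [ffun u => dfwith w (act v x (w v)) u].
have mvE v x w : mv v x w v = act v x (w v) by rewrite ffunE dfwith_in.
have mv_out v x w u : u != v -> mv v x w u = w u.
  by move=> nuv; rewrite ffunE dfwith_out // eq_sym.
have mvM v x y w : mv v (x * y) w = mv v y (mv v x w).
  apply/ffunP => u; have [->|nuv] := eqVneq u v; last by rewrite !mv_out.
  by rewrite !mvE -[w v]rK !actE mulgA.
have mv1 v w : mv v 1 w = w.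
  apply/ffunP => u; have [->|nuv] := eqVneq u v; last by rewrite !mv_out.
  by rewrite mvE -[w v]rK actE mulg1.
have inj_mv v x : injective (mv v x).
  by move=> w w' /(congr1 (mv v x^-1)); rewrite -!mvM mulgV !mv1.
exists Om, (fun v x => perm (inj_mv v x)); split=> [|v x y|v x w].
  by apply/card_gt0P; exists [ffun v => e v 1].
  by apply/permP => w; rewrite permM !permE mvM.
rewrite permE => /(congr1 (fun f : Om => f v)); rewrite mvE -[w v]rK actE => /esym /eE.
by rewrite mulKg.
Qed.

End CosetAction.

(** * Double cosets and crossed maps *)

Section DoubleCosets.
Variables (G A : groupType) (H : set G) (j : A -> G).
Hypotheses (sgH : subgroup H) (homj : hom j).

(** The double coset H p j(A): in the application, a vertex or an edge of the
    quotient graph. *)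
Definition dcoset (p : G) : set G :=
  [set q | exists h a, H h /\ q = h * p * j a].

Lemma dcoset_refl p : dcoset p p.
Proof. by exists 1, 1; rewrite (hom1 homj) mul1g mulg1; split=> //; apply: subgroup1. Qed.

Lemma dcosetMr p a : dcoset p (p * j a).
Proof. by exists 1, a; rewrite mul1g; split=> //; apply: subgroup1. Qed.

Lemma dcosetMl p h : H h -> dcoset p (h * p).
Proof. by exists h, 1; rewrite (hom1 homj) mulg1. Qed.

Lemma dcoset_eq p q : dcoset p q -> dcoset q = dcoset p.
Proof.
case=> h [a [Hh ->]]; apply/seteqP; split=> _ [k [b [Hk ->]]].
  exists (k * h), (a * b); rewrite homj !mulgA; split=> //.
  exact: subgroupM.
exists (k * h^-1), (a^-1 * b); rewrite homj (homV homj) !mulgA mulgVK mulgK.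
by split=> //; apply: subgroupM; rewrite ?subgroupVE.
Qed.

Lemma dcoset_sym p q : dcoset p q -> dcoset q p.
Proof. by move/dcoset_eq->; apply: dcoset_refl. Qed.

(** The stabiliser in A of the coset H p, under right multiplication through j. *)
Definition stab (p : G) : set A := [set a | H (p * j a * p^-1)].

Lemma stab_subgroup p : subgroup (stab p).
Proof.
apply: subgroup_intro => [|a b|a]; rewrite /stab /=.
- by rewrite (hom1 homj) mulg1 mulgV; apply: subgroup1.
- by move=> Ha Hb; have := subgroupM sgH Ha Hb; rewrite homj !mulgA mulgVK.
- by move=> Ha; have := subgroupV sgH Ha; rewrite !invgM invgK (homV homj) mulgA.
Qed.

Variable rep : G -> G.
Hypothesis rep_dcoset : forall p, dcoset p (rep p).
Hypothesis rep_eq : forall p q, dcoset p q -> rep q = rep p.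

Lemma rep_id p : rep (rep p) = rep p.
Proof. exact/rep_eq/rep_dcoset. Qed.

(** The position of the coset H p in its A-orbit, measured from the representative. *)
Definition coord (p : G) : A := xget 1 [set a | H (p * (rep p * j a)^-1)].

Lemma coordP p : H (p * (rep p * j (coord p))^-1).
Proof.
suff : [set a | H (p * (rep p * j a)^-1)] (coord p) by [].
apply: xgetPex; have [h [a [Hh defp]]] := dcoset_sym (rep_dcoset p).
by exists a; rewrite /= {1}defp -(mulgA h) mulgK.
Qed.

Lemma repMl p h : H h -> rep (h * p) = rep p.
Proof. by move=> Hh; apply/rep_eq/dcosetMl. Qed.

Lemma repMr p a : rep (p * j a) = rep p.
Proof. exact/rep_eq/dcosetMr. Qed.

Lemma coordMl p h : H h -> coord (h * p) = coord p.
Proof.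
move=> Hh; rewrite /coord repMl //; congr xget; apply/seteqP.
by split=> a /=; rewrite -mulgA (subgroupMl _ sgH Hh).
Qed.

Lemma coord_stab p a : stab (rep p) (coord p * a * (coord (p * j a))^-1).
Proof.
have Hp := coordP p; have := coordP (p * j a); rewrite repMr.
move/(subgroupM sgH (subgroupV sgH Hp)); rewrite /stab /= !homj (homV homj).
by rewrite !invgM !invgK !mulgA mulgVK.
Qed.

(** 1-cocycles of A with values in the Z/2-valued functions on H \ G. *)
Definition crossed (c : G -> A -> bool) : Prop :=
  (forall p a b, c p (a * b) = c p a (+) c (p * j a) b) /\
  (forall h p a, H h -> c (h * p) a = c p a).

(** Shapiro's lemma in degree 1: homomorphisms from the stabilisers of the orbit
    representatives induce a crossed map. *)
Definition induce (psi : G -> A -> bool) (p : G) (a : A) : bool :=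
  psi (rep p) (coord p * a * (coord (p * j a))^-1).

Lemma induce_crossed psi :
  (forall p, additive_on (stab p) (psi p)) -> crossed (induce psi).
Proof.
move=> addpsi; split=> [p a b|h p a Hh]; last first.
  by rewrite /induce -(mulgA h) !(coordMl _ Hh) (repMl _ Hh).
rewrite /induce repMr -addpsi; first by congr psi; rewrite !mulgA mulgVK homj mulgA.
  exact: coord_stab.
by rewrite -{1}(repMr p a); apply: coord_stab.
Qed.

Lemma induceE psi p a : (forall p, additive_on (stab p) (psi p)) ->
  rep p = p -> stab p a -> induce psi p a = psi p a.
Proof.
move=> addpsi repp sa; rewrite /induce repp.
have -> : coord (p * j a) = coord p by rewrite -[p * j a](mulgVK p) coordMl.
have sc : stab p (coord p).
  rewrite /stab /= -(subgroupVE _ sgH) !invgM invgK mulgA.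
  by have := coordP p; rewrite repp invgM mulgA.
by rewrite (additiveJ (stab_subgroup p)).
Qed.

End DoubleCosets.

Section CanonicalRep.
Variables (G A : groupType) (H : set G) (j : A -> G).
Hypotheses (sgH : subgroup H) (homj : hom j).

Definition canon_rep (p : G) : G := xget 1 (dcoset H j p).

Lemma canon_rep_dcoset p : dcoset H j p (canon_rep p).
Proof. by apply: xgetPex; exists p; apply: dcoset_refl. Qed.

Lemma canon_rep_eq p q : dcoset H j p q -> canon_rep q = canon_rep p.
Proof. by move=> pq; rewrite /canon_rep (dcoset_eq sgH homj pq). Qed.

(** On a free orbit a crossed map is determined by its values along one orbit
    representative, and these values are a potential b for it. *)
Lemma crossed_free c : (forall p a, stab H j p a -> a = 1) -> crossed H j c ->
  exists2 b : G -> bool, (forall h p, H h -> b (h * p) = b p) &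
    forall p a, c p a = b p (+) b (p * j a).
Proof.
move=> free [cM cH]; exists (fun p => c (canon_rep p) (coord H j canon_rep p)).
  by move=> h p Hh; rewrite (repMl homj canon_rep_eq) // (coordMl sgH homj canon_rep_eq).
move=> p a; rewrite (repMr sgH canon_rep_eq).
have -> : coord H j canon_rep (p * j a) = coord H j canon_rep p * a.
  apply/esym/divg1_eq/(free (canon_rep p)).
  exact: (coord_stab sgH homj canon_rep_dcoset canon_rep_eq).
have Hp := coordP sgH homj canon_rep_dcoset p.
rewrite cM addbA addbb; set q := canon_rep p * _; rewrite -[in LHS](mulgVK q p).
by rewrite cH.
Qed.

End CanonicalRep.

(** * Cocycles on a group given by stable letters *)

Section Twisted.
Variable G : groupType.

(** The semidirect product of G with the functions from G to Z/2, on which G acts by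
    right translation.  A lift to it of the identity of G is a cocycle, so that the
    universal property of G applied to this group produces cocycles. *)
Definition twisted : Type := (G * (G -> bool))%type.
HB.instance Definition _ := Choice.on twisted.

Definition twisted_mul (a b : twisted) : twisted :=
  (a.1 * b.1, fun p => a.2 p (+) b.2 (p * a.1)).
Definition twisted_one : twisted := (1, fun _ => false).
Definition twisted_inv (a : twisted) : twisted :=
  (a.1^-1, fun p => a.2 (p * a.1^-1)).

Fact twisted_mulA : associative twisted_mul.
Proof.
move=> [a f] [b g] [c h]; rewrite /twisted_mul /= mulgA; congr pair.
by apply/funext=> p; rewrite addbA mulgA.
Qed.

Fact twisted_mul1g : left_id twisted_one twisted_mul.
Proof.
move=> [a f]; rewrite /twisted_mul /= mul1g; congr pair.
by apply/funext=> p; rewrite mulg1.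
Qed.

Fact twisted_mulg1 : right_id twisted_one twisted_mul.
Proof.
move=> [a f]; rewrite /twisted_mul /= mulg1; congr pair.
by apply/funext=> p; rewrite addbF.
Qed.

Fact twisted_mulVg : left_inverse twisted_one twisted_inv twisted_mul.
Proof.
move=> [a f]; rewrite /twisted_mul /= mulVg; congr pair.
by apply/funext=> p; rewrite addbb.
Qed.

Fact twisted_mulgV : right_inverse twisted_one twisted_inv twisted_mul.
Proof.
move=> [a f]; rewrite /twisted_mul /= mulgV; congr pair.
by apply/funext=> p; rewrite mulgK addbb.
Qed.

HB.instance Definition _ := isGroup.Build twisted
  twisted_mulA twisted_mul1g twisted_mulg1 twisted_mulVg twisted_mulgV.

End Twisted.

(** G is presented by vertex groups, and a stable letter for every edge that
    conjugates one embedding of the edge group into the other: the fundamental group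
    of a graph of groups without tree relators, where each pair of opposite edges
    is represented by one of its members. *)
Record amalgam (G : groupType) := Amalgam {
  vert : choiceType;
  vgrp : vert -> groupType;
  vin : forall v, vgrp v -> G;
  edg : choiceType;
  esrc : edg -> vert;
  etgt : edg -> vert;
  egrp : edg -> groupType;
  ein_src : forall e, egrp e -> vgrp (esrc e);
  ein_tgt : forall e, egrp e -> vgrp (etgt e);
  stable : edg -> G;
  vin_hom : forall v, hom (@vin v);
  ein_src_hom : forall e, hom (@ein_src e);
  ein_tgt_hom : forall e, hom (@ein_tgt e);
  stable_rel : forall e (g : egrp e),
    vin (ein_src g) * stable e = stable e * vin (ein_tgt g);
  amalgam_ind : forall P : set G, subgroup P ->
    (forall v x, P (@vin v x)) -> (forall e, P (stable e)) -> forall g, P g;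
  amalgam_map : forall (K : groupType) (f : forall v, vgrp v -> K) (k : edg -> K),
    (forall v, hom (f v)) ->
    (forall e (g : egrp e), f _ (@ein_src e g) * k e = k e * f _ (ein_tgt g)) ->
    exists F : G -> K, [/\ hom F, forall v x, F (vin x) = f v x &
                          forall e, F (stable e) = k e] }.

Section Cocycles.
Variables (G : groupType) (D : amalgam G) (H : set G).
Hypothesis sgH : subgroup H.
Implicit Types (v : vert D) (e : edg D) (p : G).

Definition cocycle (c : G -> G -> bool) : Prop := crossed H (fun g => g) c.

(** Restricting the first argument to 1 turns cocycles into homomorphisms. *)
Lemma cocycle_additive c : cocycle c -> additive_on H (c 1).
Proof.
case=> cM cH x y Hx _; rewrite cM mul1g; congr addb.
by rewrite -{1}[x]mulg1 cH.
Qed.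

Lemma cocycle1 c p : cocycle c -> c p 1 = false.
Proof. by case=> cM _; have := cM p 1 1; rewrite /= !mulg1; case: (c p 1). Qed.

Lemma cocycleV c p q : cocycle c -> c p q^-1 = c (p * q^-1) q.
Proof.
move=> cc; have := cocycle1 p cc; rewrite -{1}(mulVg q) cc.1.
by case: (c p _); case: (c _ q).
Qed.

Lemma cocycle_divE c p q : cocycle c -> H (p * q^-1) ->
  c 1 (p * q^-1) = c 1 p (+) c 1 q.
Proof.
move=> cc Hpq; rewrite cc.1 mul1g cocycleV //; congr addb.
by rewrite -[p * q^-1]mulg1 cc.2.
Qed.

Variables (cv : forall v, G -> vgrp v -> bool) (ce : edg D -> G -> bool).
Hypothesis cv_crossed : forall v, crossed H (@vin _ D v) (@cv v).
Hypothesis ce_inv : forall e h p, H h -> ce e (h * p) = ce e p.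
Hypothesis cve_rel : forall e p (g : egrp e),
  cv p (ein_src g) (+) ce e (p * vin (ein_src g)) =
  ce e p (+) cv (p * stable e) (ein_tgt g).

(** The relators of G are exactly the compatibility condition on cv and ce. *)
Lemma extend_cocycle : exists c : G -> G -> bool,
  [/\ cocycle c, forall v p (x : vgrp v), c p (vin x) = cv p x &
      forall e p, c p (stable e) = ce e p].
Proof.
pose f v (x : vgrp v) : twisted G := (vin x, fun p => cv p x).
pose k e : twisted G := (stable e, ce e).
have [F [homF Fv Fe]] : exists F : G -> twisted G, [/\ hom F,
    forall v (x : vgrp v), F (vin x) = f v x & forall e, F (stable e) = k e].
  apply: amalgam_map => [v x y|e g].
    rewrite /f /mul /= /twisted_mul /= vin_hom; congr pair.
    by apply/funext=> p; rewrite (cv_crossed v).1.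
  rewrite /f /k /mul /= /twisted_mul /= stable_rel; congr pair.
  by apply/funext=> p; apply: cve_rel.
pose good : set G := [set g | (F g).1 = g /\
  forall h p, H h -> (F g).2 (h * p) = (F g).2 p].
have allgood g : good g.
  apply: amalgam_ind => [|v x|e].
  - apply: subgroup_intro; first by rewrite /good /= (hom1 homF).
      move=> x y [Fx cx] [Fy cy]; rewrite /good /= homF /=; split.
        by rewrite Fx Fy.
      by move=> h p Hh; rewrite cx // Fx -mulgA (cy h).
    move=> x [Fx cx]; rewrite /good /= (homV homF) /=; split; first by rewrite Fx.
    by move=> h p Hh; rewrite Fx -mulgA (cx h).
  - by rewrite /good /=; case: (F _) (Fv v x) => a b [-> ->]; split=> // h p Hh; apply: (cv_crossed v).2.
  - by rewrite /good /=; case: (F _) (Fe e) => a b [-> ->]; split=> // h p Hh; apply: ce_inv.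
exists (fun p g => (F g).2 p); split; last by move=> e p; rewrite Fe.
  split=> [p a b|h p a Hh]; last by rewrite (allgood a).2.
  by rewrite homF /= (allgood a).1.
by move=> v p x; rewrite Fv.
Qed.

End Cocycles.

Section ExtendVertex.
Variables (G : groupType) (D : amalgam G) (H : set G).
Hypothesis sgH : subgroup H.
Hypothesis src_free : forall e p (g : egrp e),
  H (p * @vin _ D _ (ein_src g) * p^-1) -> g = 1.
Hypothesis tgt_free : forall e p (g : egrp e),
  H (p * @vin _ D _ (ein_tgt g) * p^-1) -> g = 1.

(** Freeness makes cv a coboundary along each edge group; stable letters receive the
    sum of the potentials at both ends of the edge. *)
Lemma extend_vertex_cocycle (cv : forall v : vert D, G -> vgrp v -> bool) :
  (forall v, crossed H (@vin _ D v) (cv v)) ->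
  exists2 c : G -> G -> bool, cocycle H c & forall v p (x : vgrp v), c p (vin x) = cv v p x.
Proof.
move=> ccv.
have triv (e : edg D) (w : vert D) (j : egrp e -> vgrp w) : hom j ->
    (forall p g, H (p * vin (j g) * p^-1) -> g = 1) ->
  {b : G -> bool | (forall h p, H h -> b (h * p) = b p) /\
    forall p g, cv w p (j g) = b p (+) b (p * vin (j g))}.
  move=> homj free; apply: cid.
  have homvj : hom (@vin _ D w \o j) by move=> x y; rewrite /= homj vin_hom.
  have [] := @crossed_free _ _ _ _ sgH homvj (fun p g => cv w p (j g)) free.
    split=> [p a b|h p a Hh]; first by rewrite homj (ccv w).1.
    by rewrite (ccv w).2.
  by move=> b bH bE; exists b.
pose bs e := sval (triv e _ _ (@ein_src_hom _ D e) (@src_free e)).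
pose bt e := sval (triv e _ _ (@ein_tgt_hom _ D e) (@tgt_free e)).
have [bsH bsE] := all_and2 (fun e => svalP (triv e _ _ (@ein_src_hom _ D e) (@src_free e))).
have [btH btE] := all_and2 (fun e => svalP (triv e _ _ (@ein_tgt_hom _ D e) (@tgt_free e))).
have [|||c [cc cE _]] := @extend_cocycle _ D H cv (fun e p => bs e p (+) bt e (p * stable e)).
- exact: ccv.
- by move=> e h p Hh; rewrite /bs /bt (bsH e h) // -mulgA (btH e h).
- move=> e p g; rewrite bsE btE /bs /bt -!mulgA -stable_rel.
  set a := sval _ p; set b := sval _ (p * vin _); set d := sval _ (p * stable e).
  by set f := sval _ (p * _); case: a; case: b; case: d; case: f.
- by exists c.
Qed.

Lemma extend_edge_cocycle (k : edg D -> G -> bool) :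
    (forall e h p, H h -> k e (h * p) = k e p) ->
    (forall e p g, k e (p * @vin _ D _ (@ein_src _ D e g)) = k e p) ->
  exists c : G -> G -> bool,
    [/\ cocycle H c, forall (v : vert D) p (x : vgrp v), c p (vin x) = false &
        forall e p, c p (stable e) = k e p].
Proof.
move=> kH kE; apply: (@extend_cocycle _ D H (fun v _ _ => false)) => //.
by move=> e p g; rewrite /= kE addbF.
Qed.

End ExtendVertex.

(** * The quotient graph and its spanning tree *)

Section QuotientGraph.
Variables (G : groupType) (D : amalgam G) (H : set G) (v0 : vert D).
Hypothesis sgH : subgroup H.
Implicit Types (v w : vert D) (e : edg D) (p q : G).

(** Elements spelled by the paths of the graph of groups from v0 to v.  The whole
    group also contains words that do not follow the graph, because stable letters
    of tree edges are not killed. *)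
Inductive reach : vert D -> G -> Prop :=
| Reach0 : reach v0 1
| ReachV v p (x : vgrp v) of reach v p : reach v (p * vin x)
| ReachE e p of reach (esrc e) p : reach (etgt e) (p * stable e)
| ReachEV e p of reach (etgt e) p : reach (esrc e) (p * (stable e)^-1).

Local Notation vclass v := (dcoset H (@vin _ D v)).
Local Notation eincl e := (fun g : egrp e => @vin _ D _ (ein_src g)).

Let homv v : hom (@vin _ D v). Proof. exact: vin_hom. Qed.
Lemma eincl_hom e : hom (eincl e).
Proof. by move=> x y; rewrite /= ein_src_hom vin_hom. Qed.

(** An edge with a direction of travel; [true] means backwards. *)
Definition dart : choiceType := (edg D * bool)%type.
Definition dsrc (d : dart) := if d.2 then etgt d.1 else esrc d.1.
Definition dtgt (d : dart) := if d.2 then esrc d.1 else etgt d.1.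
Definition dstep (d : dart) : G := if d.2 then (stable d.1)^-1 else stable d.1.

Definition leads_to (d : dart) p w q : Prop :=
  dtgt d = w /\ vclass w (p * dstep d) q.

(** The class of (v, p) is joined to the base class by a path of n darts. *)
Fixpoint near n v p : Prop :=
  if n is n'.+1 then exists d q, near n' (dsrc d) q /\ leads_to d q v p
  else v = v0 /\ vclass v 1 p.

Let vclass_trans v p q r : vclass v p q -> vclass v q r -> vclass v p r.
Proof. by move/(dcoset_eq sgH (@homv v)) => ->. Qed.

Lemma near_class n v p q : vclass v p q -> near n v p -> near n v q.
Proof.
case: n => [|n] pq /=; first by case=> ? vp; split=> //; apply: vclass_trans vp pq.
case=> d [r [dr [vd rp]]]; exists d, r; split=> //; split=> //.
exact: vclass_trans rp pq.
Qed.

Definition reached v p : Prop := exists n, near n v p.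

Lemma reached_class v p q : vclass v p q -> reached v p -> reached v q.
Proof. by move=> pq [n np]; exists n; apply: near_class np. Qed.

Lemma reached_step d p : reached (dsrc d) p -> reached (dtgt d) (p * dstep d).
Proof.
case=> n np; exists n.+1, d, p; split=> //; split=> //.
exact: (dcoset_refl sgH (@homv _)).
Qed.

Lemma reach_reached v p : reach v p -> reached v p.
Proof.
elim=> {v p} [|v p x _ IH|e p _ IH|e p _ IH].
- by exists 0%N; split=> //; apply: (dcoset_refl sgH (@homv _)).
- exact: reached_class (dcosetMr _ sgH _ _) IH.
- exact: (@reached_step (e, false)).
- exact: (@reached_step (e, true)).
Qed.

(** The parent of a class is chosen from the class alone, so that it does not
    depend on the element [q] representing it. *)
Definition parent n w q : option (dart * G) :=
  xget None [set o | if o is Some (d, p) then near n (dsrc d) p /\ leads_to d p w q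
                     else False].

Lemma leads_to_class d p w q r : vclass w q r -> leads_to d p w q -> leads_to d p w r.
Proof. by move=> qr [dw pq]; split=> //; apply: vclass_trans pq qr. Qed.

Lemma parent_class n w q r : vclass w q r -> parent n w r = parent n w q.
Proof.
move=> qr; have rq := dcoset_sym sgH (@homv _) qr.
rewrite /parent; congr xget; apply/seteqP; split=> -[[d p]|] //= [np dp]; split=> //.
  exact: leads_to_class rq dp.
exact: leads_to_class qr dp.
Qed.

Lemma parentP n w q : near n.+1 w q -> exists d p,
  [/\ parent n w q = Some (d, p), near n (dsrc d) p & leads_to d p w q].
Proof.
case=> d [p np]; suff : [set o | if o is Some (d, p)
    then near n (dsrc d) p /\ leads_to d p w q else False] (parent n w q).
  by case: (parent n w q) => [[d' p']|] //= [np' dp']; exists d', p'.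
by apply: xgetPex; exists (Some (d, p)).
Qed.

(** The representative of the coset H p in t G_v. *)
Definition anchored (t : G) v p : G :=
  xget 1 [set r | H (r * p^-1) /\ exists x : vgrp v, r = t * vin x].

Lemma anchoredP t v p : vclass v p t ->
  H (anchored t v p * p^-1) /\ exists x : vgrp v, anchored t v p = t * vin x.
Proof.
case=> h [x [Hh ->]].
suff : [set r | H (r * p^-1) /\ exists y : vgrp v, r = h * p * vin x * vin y]
  (anchored (h * p * vin x) v p) by [].
apply: xgetPex; exists (h * p); split; first by rewrite mulgK.
by exists x^-1; rewrite (homV (@homv v)) mulgK.
Qed.

Lemma anchoredMl t v p h : H h -> anchored t v (h * p) = anchored t v p.
Proof.
move=> Hh; rewrite /anchored; congr xget; apply/seteqP.
have HhV := subgroupV sgH Hh.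
split=> r /= [Hr tr]; split=> //; move: Hr;
  by rewrite invgM mulgA (subgroupMr _ sgH HhV).
Qed.

(** Representatives of classes, spelled along the path to the base in the tree given
    by [parent]. *)
Fixpoint bfs_rep n v p : G :=
  if n isn't n'.+1 then 1 else
  if parent n' v p is Some (d, q) then
    anchored (bfs_rep n' (dsrc d) q) (dsrc d) q * dstep d else 1.

Lemma bfs_rep_eq n v p q : vclass v p q -> bfs_rep n v q = bfs_rep n v p.
Proof. by case: n => [//|n] pq /=; rewrite (parent_class _ pq). Qed.

Lemma bfs_rep_class n v p : near n v p -> vclass v p (bfs_rep n v p).
Proof.
elim: n v p => [|n IHn] v p; first by case=> _ /(dcoset_sym sgH (@homv _)).
move=> /parentP [d [q [/= -> /IHn /anchoredP [Ha _]]]] [dv qp].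
set a := anchored _ _ _ in Ha *; apply: vclass_trans (dcoset_sym sgH (@homv _) qp) _.
have -> : a * dstep d = a * q^-1 * (q * dstep d) by rewrite mulgA mulgVK.
exact: dcosetMl.
Qed.

Definition level v p : nat :=
  xget 0%N [set n | near n v p /\ forall m, near m v p -> (n <= m)%N].

Lemma levelP v p : reached v p ->
  near (level v p) v p /\ forall m, near m v p -> (level v p <= m)%N.
Proof.
case=> n np; suff : [set n | near n v p /\ forall m, near m v p -> (n <= m)%N] (level v p) by [].
have exn : exists n, `[< near n v p >] by exists n; apply/asboolP.
apply: xgetPex; case: (ex_minnP exn) => m /asboolP mp min; exists m; split=> // k kp.
by apply/min/asboolP.
Qed.

Lemma level_class v p q : vclass v p q -> level v q = level v p.
Proof.
move=> pq; have qp := dcoset_sym sgH (@homv _) pq; rewrite /level; congr xget; apply/seteqP.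
by split=> n [np min]; split; [|move=> m mp; apply: min| |move=> m mp; apply: min];
  apply: near_class; eassumption.
Qed.

(** Unreachable classes carry arbitrary representatives; cocycles must be defined on
    them too. *)
Definition node v p : G :=
  if `[< reached v p >] then bfs_rep (level v p) v p else canon_rep H (@vin _ D v) p.

Lemma node_class v p : vclass v p (node v p).
Proof.
rewrite /node; case: asboolP => [/levelP [/bfs_rep_class]//|_].
exact: (canon_rep_dcoset sgH (@homv _)).
Qed.

Lemma node_eq v p q : vclass v p q -> node v q = node v p.
Proof.
move=> pq; have qp := dcoset_sym sgH (@homv _) pq; rewrite /node.
rewrite (level_class pq) (bfs_rep_eq _ pq) (canon_rep_eq sgH (@homv _) pq).
suff -> : `[< reached v q >] = `[< reached v p >] by [].
by apply/asboolP/asboolP; apply: reached_class.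
Qed.

(** A Schreier transversal: representatives of cosets H p that follow the tree and
    then move inside one vertex group. *)
Definition transv v p : G := anchored (node v p) v p.

Lemma transvP v p : H (transv v p * p^-1).
Proof. by have [] := anchoredP (node_class v p). Qed.

Lemma transv_node v p : exists x : vgrp v, transv v p = node v p * vin x.
Proof. by have [] := anchoredP (node_class v p). Qed.

Lemma transvMl v p h : H h -> transv v (h * p) = transv v p.
Proof.
move=> Hh; rewrite /transv anchoredMl //; congr anchored.
by apply: node_eq; apply: (dcosetMl (@homv _)).
Qed.

Definition eclass_rep e p : G := canon_rep H (eincl e) p.
Definition dedge (d : dart) p : edg D * G :=
  (d.1, eclass_rep d.1 (if d.2 then p * (stable d.1)^-1 else p)).

(** Edge classes used by a class of positive minimal level to reach its parent. *)
Definition tree_edge (er : edg D * G) : Prop :=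
  exists w q d p, [/\ near (level w q) w q, (0 < level w q)%N,
    (forall m, near m w q -> level w q <= m)%N,
    parent (level w q).-1 w q = Some (d, p) & dedge d p = er].

Lemma node_step w q n : reached w q -> level w q = n.+1 -> exists d p,
  [/\ parent n w q = Some (d, p), near n (dsrc d) p, leads_to d p w q,
      level (dsrc d) p = n /\ tree_edge (dedge d p) &
      node w q = transv (dsrc d) p * dstep d].
Proof.
move=> rq lq; have [near_q min_q] := levelP rq.
have nq := near_q; rewrite lq in nq; have [d [p [par np dp]]] := parentP nq.
have lp : level (dsrc d) p = n.
  have [np' min_p] := levelP (ex_intro _ n np).
  apply/eqP; rewrite eqn_leq min_p //= -ltnS -lq; apply: min_q.
  by exists d, p.
exists d, p; split=> //.
  by split=> //; exists w, q, d, p; split=> //; rewrite lq.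
rewrite /node asboolT // lq /= par /transv /node asboolT; last by exists n.
by rewrite lp.
Qed.

(** Transversal elements are products of tree edges and vertex group elements. *)
Lemma transv_vanish c : cocycle H c -> (forall v p (x : vgrp v), c p (vin x) = false) ->
    (forall d p, tree_edge (dedge d p) -> c p (dstep d) = false) ->
  forall v p, reached v p -> c 1 (transv v p) = false.
Proof.
move=> cc cv ct v p; move def_n: (level v p) => n.
elim: n v p def_n => [|n IHn] v p lp rp; have [x ->] := transv_node v p;
  rewrite cc.1 cv addbF.
  by rewrite /node asboolT // lp; apply: cocycle1 cc.
have [d [q [_ nq _ [lq tq] ->]]] := node_step rp lp.
rewrite cc.1 IHn //= ?mul1g; last by exists n.
by rewrite -[transv _ q](mulgVK q) cc.2 ?ct //; apply: transvP.
Qed.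

(** Vertex stabilisers, carried to the base point along the tree. *)
Definition vloops : set G :=
  [set k | H k /\ exists v p (x : vgrp v), k = node v p * vin x * (node v p)^-1].

(** Out along the tree, across the edge e, and back along the tree. *)
Definition eloop e p : G :=
  transv (esrc e) p * stable e * (transv (etgt e) (p * stable e))^-1.

Lemma eloop_in e p : H (eloop e p).
Proof.
have h1 := transvP (esrc e) p; have h2 := transvP (etgt e) (p * stable e).
have := subgroupM sgH h1 (subgroupV sgH h2).
by rewrite (invgM (transv _ _)) invgK !mulgA mulgVK.
Qed.

Lemma vloop_transv v p (x : vgrp v) :
  vloops (transv v p * vin x * (transv v (p * vin x))^-1).
Proof.
split.
  have h1 := transvP v p; have h2 := transvP v (p * vin x).
  have := subgroupM sgH h1 (subgroupV sgH h2).
  by rewrite invgM invgK !mulgA mulgVK.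
have [y ->] := transv_node v p; have [z ->] := transv_node v (p * vin x).
rewrite (node_eq (dcosetMr _ sgH p x)); exists v, p, (y * x * z^-1).
by rewrite !(@homv v) (homV (@homv v)) invgM !mulgA.
Qed.

Section Generation.
Variable K : set G.
Hypotheses (sgK : subgroup K) (Kv : vloops `<=` K).

(** Loops across parallel representatives of an edge class differ by elements of the
    stabilisers at the two ends. *)
Lemma eloop_class e p q : dcoset H (eincl e) p q -> K (eloop e p) -> K (eloop e q).
Proof.
case=> h [g [Hh ->]] Kp; set j := eincl e g.
have -> : eloop e (h * p * j) = eloop e (p * j).
  by rewrite /eloop -!mulgA !(transvMl _ _ Hh).
have k1 := Kv (vloop_transv p (ein_src g)).
have k2 := Kv (vloop_transv (p * stable e) (ein_tgt g)).
have := subgroupM sgK (subgroupM sgK (subgroupV sgK k1) Kp) k2.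
rewrite /eloop /j -(mulgA p (vin _)) stable_rel !mulgA !invgM !invgK.
set a := transv _ p; set b := transv _ (p * stable e).
rewrite !mulgA !mulgVK.
rewrite -(mulgA _ (stable e) (vin _)) -stable_rel.
by rewrite !mulgA mulgVK.
Qed.

(** Across a tree edge, the transversals on both sides agree up to an element of the
    vertex group. *)
Lemma eloop_tree e p : tree_edge (e, eclass_rep e p) -> K (eloop e p).
Proof.
case=> w [q [d [r [nq lq_gt0 _ par]]]].
have rq : reached w q by exists (level w q).
have [d' [r' [par' _ [dw rq'] _ nodeq]]] := node_step rq (esym (prednK lq_gt0)).
move: par'; rewrite par => -[? ?]; subst d' r'; move: d dw rq' nodeq {par} => [e' b] dw rq' nodeq.
rewrite /dedge /= => -[eqe]; subst e'; rewrite /eclass_rep => eqr.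
have same p' : canon_rep H (eincl e) p' = canon_rep H (eincl e) p -> K (eloop e p') -> K (eloop e p).
  move=> eqc; apply: eloop_class.
  have := canon_rep_dcoset sgH (@eincl_hom e) p'; rewrite eqc => cp.
  have := dcoset_sym sgH (@eincl_hom e) (canon_rep_dcoset sgH (@eincl_hom e) p).
  by rewrite (dcoset_eq sgH (@eincl_hom e) cp).
apply: same eqr _; apply: Kv; split; first exact: eloop_in.
rewrite /dsrc /dtgt /dstep /= in dw rq' nodeq.
(* The parent may lie at either end of the edge. *)
case: b dw rq' nodeq => /= dw rq' nodeq; subst w.
  rewrite /eloop mulgVK; have [x ->] := transv_node (esrc e) (r * (stable e)^-1).
  rewrite -(node_eq rq'); exists (esrc e), q, x.
  by rewrite {3}nodeq invgM invgK !mulgA.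
rewrite /eloop; have [x ->] := transv_node (etgt e) (r * stable e).
rewrite -(node_eq rq'); exists (etgt e), q, x^-1.
by rewrite -nodeq invgM (homV (@homv _)) !mulgA.
Qed.

Hypothesis Ke : forall e p, reached (esrc e) p -> K (eloop e p).

(** Reidemeister-Schreier rewriting along a path. *)
Lemma generated_reach v p : reach v p -> K (p * (transv v p)^-1).
Proof.
elim=> {v p} [|v p x rp IH|e p rp IH|e p rp IH].
- rewrite mul1g subgroupVE //; apply: Kv; split.
    by rewrite -[transv _ _](mulgVK 1); apply: subgroupM => //; [apply: transvP|apply: subgroup1].
  have n1 : near 0 v0 1 by split=> //; apply: (dcoset_refl sgH (@homv _)).
  have r1 : reached v0 1 by exists 0%N.
  have l0 : level v0 1 = 0%N.
    by have [_ /(_ _ n1)] := levelP r1; rewrite leqn0 => /eqP.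
  have node1 : node v0 1 = 1 by rewrite /node asboolT ?l0.
  have [x ->] := transv_node v0 1; exists v0, 1, x.
  by rewrite node1 invg1 mulg1.
- have := subgroupM sgK IH (Kv (vloop_transv p x)).
  by rewrite !mulgA mulgVK.
- have := subgroupM sgK IH (Ke (reach_reached rp)).
  by rewrite /eloop !mulgA mulgVK.
- have re : reached (esrc e) (p * (stable e)^-1).
    exact: (@reached_step (e, true)) (reach_reached rp).
  have := subgroupM sgK IH (subgroupV sgK (Ke re)).
  by rewrite /eloop mulgVK !invgM invgK !mulgA mulgVK.
Qed.

Lemma generated_all : (forall h, H h -> reach v0 h) -> H `<=` K.
Proof.
move=> Hr h Hh; have := generated_reach (Hr _ Hh).
rewrite -[in transv _ _](mulg1 h) transvMl // subgroupMr // subgroupVE //.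
by have := generated_reach Reach0; rewrite mul1g subgroupVE.
Qed.

End Generation.
End QuotientGraph.

(** * Subgroups with few homomorphisms to Z/2 *)

Section DualFamilies.
Variables (G : groupType) (H : set G) (M : nat).

Lemma dual_finite (T : choiceType) (Q : set T) (phi : T -> G -> bool) (h : T -> G) :
    dual_bound H M -> (forall t, Q t -> H (h t)) ->
    (forall t, Q t -> additive_on H (phi t)) ->
    (forall t u, Q t -> Q u -> phi t (h u) = (t == u)) ->
  exists s : seq T, Q = [set` s].
Proof.
move=> bound Hh addphi dual; apply: (@finite_of_bounded _ _ M) => s us sQ.
have Qs i : Q (tnth (in_tuple s) i) by apply: sQ; apply: mem_tnth.
apply: (bound _ (fun i => phi (tnth (in_tuple s) i)) (fun i => h (tnth (in_tuple s) i))).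
- by move=> i; apply: Hh.
- by move=> i; apply: addphi.
- by move=> i j; rewrite dual //; apply/eqP/eqP => [|->//]; apply: (tuple_uniqP (in_tuple s) us).
Qed.

End DualFamilies.

Section FiniteGeneration.
Variables (G : groupType) (D : amalgam G) (H : set G) (v0 : vert D) (M : nat).
Hypothesis sgH : subgroup H.
Hypothesis dualH : dual_bound H M.
Hypothesis src_free : forall e p (g : egrp e),
  H (p * @vin _ D _ (ein_src g) * p^-1) -> g = 1.
Hypothesis tgt_free : forall e p (g : egrp e),
  H (p * @vin _ D _ (ein_tgt g) * p^-1) -> g = 1.
Hypothesis stab_fg : forall v p, fin_gen (stab H (@vin _ D v) p).
Hypothesis stab_hom : forall v p (x : vgrp v), stab H (@vin _ D v) p x -> x <> 1 ->
  exists2 psi, additive_on (stab H (@vin _ D v) p) psi &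
    exists2 y, stab H (@vin _ D v) p y & psi y = true.
Implicit Types (v w : vert D) (e : edg D) (p q : G).

Local Notation stab v := (stab H (@vin _ D v)).
Local Notation node := (node H v0).

Lemma cocycle_conj c p x : cocycle H c -> H (p * x * p^-1) ->
  c 1 (p * x * p^-1) = c p x.
Proof.
move=> cc Hx; rewrite (cocycle_divE cc Hx) cc.1 mul1g.
by case: (c 1 p); case: (c p x).
Qed.

(** One homomorphism to Z/2 for every vertex, nonzero when the stabiliser is
    nontrivial. *)
Lemma stab_choice v p : { psi : vgrp v -> bool | additive_on (stab v p) psi &
  forall x, stab v p x -> x <> 1 -> exists2 y, stab v p y & psi y = true }.
Proof.
apply: cid2; have [[x sx x1]|triv] := pselect (exists2 x, stab v p x & x <> 1).
  by have [psi addpsi exy] := stab_hom sx x1; exists psi.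
exists (fun _ => false); first by [].
by move=> x sx x1; case: triv; exists x.
Qed.

Definition nontrivial_node (vp : vert D * G) : Prop :=
  node vp.1 vp.2 = vp.2 /\ exists2 x, stab vp.1 vp.2 x & x <> 1.

(** For each vertex with nontrivial stabiliser, the cocycle induced from that
    stabiliser alone; dual to it is an element of the stabiliser. *)
Lemma nontrivial_node_finite : exists s : seq (vert D * G), nontrivial_node = [set` s].
Proof.
pose psi (vp : vert D * G) v p : vgrp v -> bool :=
  if (v, p) == vp then s2val (stab_choice v p) else fun _ => false.
have addpsi vp v p : additive_on (stab v p) (psi vp v p).
  by rewrite /psi; case: eqP => // _; apply: s2valP.
have indc vp v : crossed H (@vin _ D v) (induce H (@vin _ D v) (node v) (psi vp v)).
  apply: induce_crossed => //; first exact: vin_hom.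
  - exact: node_class.
  - exact: node_eq.
pose c vp := s2val (cid2 (extend_vertex_cocycle sgH src_free tgt_free (indc vp))).
have cc vp : cocycle H (c vp) by apply: s2valP.
have cE vp v p (x : vgrp v) : c vp p (vin x) = induce H (@vin _ D v) (node v) (psi vp v) p x.
  exact: (s2valP' (cid2 (extend_vertex_cocycle sgH src_free tgt_free (indc vp)))).
have wit (vp : vert D * G) : nontrivial_node vp -> exists2 y, stab vp.1 vp.2 y &
    s2val (stab_choice vp.1 vp.2) y = true.
  by case=> _ [x sx x1]; apply: (s2valP' (stab_choice vp.1 vp.2)) sx x1.
pose y (vp : vert D * G) : vgrp vp.1 :=
  xget 1 [set y | stab vp.1 vp.2 y /\ s2val (stab_choice vp.1 vp.2) y = true].
have yP vp : nontrivial_node vp -> stab vp.1 vp.2 (y vp) /\ s2val (stab_choice vp.1 vp.2) (y vp) = true.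
  move=> /wit [z sz pz].
  suff : [set y | stab vp.1 vp.2 y /\ s2val (stab_choice vp.1 vp.2) y = true] (y vp) by [].
  by apply: (@xgetI _ _ _ z).
apply: (@dual_finite _ H M _ nontrivial_node (fun vp => c vp 1)
  (fun vp => vp.2 * vin (y vp) * vp.2^-1)) => //.
- by move=> vp /yP [].
- by move=> vp _; apply: cocycle_additive (cc vp).
- move=> vp wq _ nwq; have [sy yt] := yP _ nwq.
  rewrite cocycle_conj // cE induceE //; last exact: nwq.1.
  + by rewrite /psi -surjective_pairing eq_sym; case: eqP.
  + exact: vin_hom.
  + exact: node_class.
  + exact: node_eq.
Qed.

Lemma vloops_fin_gen : exists s : seq G, gen_subgroup (vloops H v0) = gen_subgroup [set` s].
Proof.
have [t nontriv_t] := nontrivial_node_finite.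
have genP (vp : vert D * G) : exists s, generated_by (stab vp.1 vp.2) s.
  exact/fin_genP/stab_fg.
pose gens (vp : vert D * G) : seq (vgrp vp.1) := sval (cid (genP vp)).
have gensP vp : generated_by (stab vp.1 vp.2) (gens vp) by apply: svalP.
pose s := flatten [seq [seq vp.2 * vin x * vp.2^-1 | x <- gens vp] | vp <- t].
have sgs := gen_subgroupP [set` s]; exists s; apply/seteqP; split.
  apply: gen_subgroup_min => // k [Hk [v [p [x eqk]]]]; rewrite eqk in Hk *.
  have sx : stab v (node v p) x by exact: Hk.
  have [->|x1] := pselect (x = 1).
    by rewrite (hom1 (@vin_hom _ D v)) mulg1 mulgV; apply: subgroup1.
  have ntv : nontrivial_node (v, node v p).
    by split=> /=; [apply: (rep_id (node_class v0 sgH v) (node_eq v0 sgH (v:=v)))|exists x].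
  pose B := [set x | gen_subgroup [set` s] (node v p * @vin _ D v x * (node v p)^-1)].
  suff : stab v (node v p) `<=` B by apply.
  have -> := gensP (v, node v p); apply: gen_subgroup_min.
    exact: (stab_subgroup sgs (@vin_hom _ D v)).
  move=> y ys; apply: gen_subgroup_sub; apply/flattenP.
  move: ntv; rewrite nontriv_t => vt; eexists; first exact: (map_f _ vt).
  exact: (map_f (fun x => node v p * vin x * (node v p)^-1)).
apply: gen_subgroup_min; first exact: gen_subgroupP.
move=> k /flattenP [_ /mapP [[v p] vt ->] /mapP [x xs ->]].
have [/= nodep _] : nontrivial_node (v, p) by rewrite nontriv_t.
apply: gen_subgroup_sub; split; first exact: (generated_by_sub (gensP (v, p)) xs).
by exists v, p, x; rewrite nodep.
Qed.

Local Notation eclass_rep := (@eclass_rep G D H).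

Definition nontree_edge (er : edg D * G) : Prop :=
  [/\ eclass_rep er.1 er.2 = er.2, reached H v0 (esrc er.1) er.2 &
      ~ tree_edge H v0 er].

(** The indicator of a non-tree edge is dual to the loop through that edge, as loops
    otherwise run inside the tree. *)
Lemma nontree_edge_finite : exists s : seq (edg D * G), nontree_edge = [set` s].
Proof.
pose k (er : edg D * G) e p := (e, eclass_rep e p) == er.
have kH er e h p : H h -> k er e (h * p) = k er e p.
  by move=> Hh; rewrite /k /eclass_rep (repMl (@eincl_hom _ D e) (canon_rep_eq sgH (@eincl_hom _ D e))).
have kE er e p (g : egrp e) : k er e (p * vin (ein_src g)) = k er e p.
  by rewrite /k /eclass_rep (repMr sgH (canon_rep_eq sgH (@eincl_hom _ D e))).
pose c er := sval (cid (extend_edge_cocycle (kH er) (kE er))).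
have [cc cv ce] : [/\ forall er, cocycle H (c er),
    forall er v p (x : vgrp v), c er p (vin x) = false &
    forall er e p, c er p (stable e) = k er e p].
  by split=> er; case: (svalP (cid (extend_edge_cocycle (kH er) (kE er)))).
have van er v p : nontree_edge er -> reached H v0 v p -> c er 1 (transv H v0 v p) = false.
  move=> [_ _ ntree] rp; apply: (transv_vanish sgH (cc er) (cv er)) rp => -[e b] q tq.
  have ek q' : tree_edge H v0 (e, eclass_rep e q') -> c er q' (stable e) = false.
    by rewrite ce /k; case: eqP => // -> /ntree.
  case: b tq; rewrite /dedge /dstep /=; last exact: ek.
  by rewrite (cocycleV _ _ (cc er)); apply: ek.
apply: (@dual_finite _ H M _ nontree_edge (fun er => c er 1)
  (fun er => eloop H v0 er.1 er.2)) => //.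
- by move=> er _; apply: eloop_in.
- by move=> er _; apply: cocycle_additive (cc er).
- move=> er [e p] nter [/= repp rp _].
  have rt : reached H v0 (etgt e) (p * stable e) by apply: (reached_step sgH (d := (e, false))).
  rewrite /= (cocycle_divE (cc er)); last exact: eloop_in.
  rewrite (van _ _ _ nter rt) addbF (cc er).1 (van _ _ _ nter rp) mul1g /= ce.
  rewrite -[transv _ _ _ p](mulgVK p) kH; last exact: transvP.
  by rewrite /k repp eq_sym.
Qed.

Theorem subgroup_fin_gen : (forall h, H h -> reach v0 v0 h) -> fin_gen H.
Proof.
move=> Hr; have [s defs] := vloops_fin_gen; have [t nontree_t] := nontree_edge_finite.
apply/fin_genP; exists (s ++ [seq eloop H v0 er.1 er.2 | er <- t]).
have subv : vloops H v0 `<=` H by move=> x [].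
apply: generated_by_intro => //.
  move=> x /=; rewrite mem_cat => /orP [xs|/mapP [er _ ->]]; last exact: eloop_in.
  have : gen_subgroup (vloops H v0) x by rewrite defs; apply: gen_subgroup_sub.
  exact: gen_subgroup_min.
set K := gen_subgroup _; have sgK : subgroup K by apply: gen_subgroupP.
have Kv : vloops H v0 `<=` K.
  move=> x /gen_subgroup_sub; rewrite defs.
  by apply: gen_subgroupS => y /=; rewrite mem_cat => ->.
apply: (generated_all sgH sgK Kv _ Hr) => e p rp.
have [tree|ntree] := pselect (tree_edge H v0 (e, eclass_rep e p)).
  exact: (eloop_tree sgH sgK Kv).
have cp := canon_rep_dcoset sgH (@eincl_hom _ D e) p.
apply: (eloop_class sgH sgK Kv (dcoset_sym sgH (@eincl_hom _ D e) cp)).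
apply: gen_subgroup_sub; rewrite /= mem_cat; apply/orP; right.
suff vt : (e, eclass_rep e p) \in t by apply: (map_f (fun er => eloop H v0 er.1 er.2) vt).
suff : nontree_edge (e, eclass_rep e p) by rewrite nontree_t.
have idp : eclass_rep e (eclass_rep e p) = eclass_rep e p.
  exact: (rep_id (canon_rep_dcoset sgH (@eincl_hom _ D e)) (canon_rep_eq sgH (@eincl_hom _ D e))).
split; rewrite //= ?idp //; case: cp => h [g [Hh eqp]].
by apply: reached_class rp => //; rewrite /eclass_rep eqp; exists h, (ein_src g).
Qed.

End FiniteGeneration.

(** * The universal property of the fundamental group *)

Section WordMap.
Variables (L : choiceType) (inv : L -> L) (r : seq L -> seq L -> Prop).
Variables (K : groupType) (phi : L -> K).
Hypothesis phiV : forall l, phi (inv l) = (phi l)^-1.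
Hypothesis phir : forall u v, r u v ->
  \prod_(l <- u) phi l = \prod_(l <- v) phi l.

Lemma word_map : exists F : word_group inv r -> K,
  hom F /\ forall u, F (word_pi inv r u) = \prod_(l <- u) phi l.
Proof.
pose val u := \prod_(l <- u) phi l.
have val_eq u v : word_eq inv r u v -> val u = val v.
  elim=> {u v} [a b u v /phir ruv|a b l|a b l|//|//|u v w _ -> //];
    rewrite /val !big_cat /= ?ruv // !big_cons big_nil mulg1 phiV.
    by rewrite mulgV mul1g.
  by rewrite mulVg mul1g.
pose F (x : word_group inv r) := val (generic_quotient.repr x).
have FE u : F (word_pi inv r u) = val u by apply/val_eq/repr_word.
exists F; split=> // x y.
elim/word_group_ind: x => u; elim/word_group_ind: y => v.
have -> : word_pi inv r u * word_pi inv r v = word_pi inv r (u ++ v) by apply: word_piM.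
by rewrite !FE /val big_cat.
Qed.

End WordMap.

Lemma word_subgroup (L : choiceType) (inv : L -> L) r (P : set (word_group inv r)) :
  subgroup P -> (forall l, P (word_pi inv r [:: l])) -> forall x, P x.
Proof.
move=> sgP Pl; elim/word_group_ind; elim=> [|l u IHu]; first exact: subgroup1 sgP.
have -> : word_pi inv r (l :: u) = word_pi inv r [:: l] * word_pi inv r u.
  by rewrite /mul /= word_piM.
exact: subgroupM.
Qed.

Section FreeMaps.
Variable K : groupType.

Lemma free_group_map (A : choiceType) (k : A -> K) :
  exists F : free_group A -> K, hom F /\ forall a, F (free_gen a) = k a.
Proof.
have [|//|F [homF FE]] := @word_map _ (@free_letter_inv A) (fun _ _ => False) K
  (fun l => if l.2 then (k l.1)^-1 else k l.1).
  by case=> a [] /=; rewrite ?invgK.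
by exists F; split=> // a; rewrite FE big_seq1.
Qed.

Lemma free_product_map (I : choiceType) (Gs : I -> groupType) (f : forall i, Gs i -> K) :
  (forall i, hom (@f i)) ->
  exists F : free_product Gs -> K, hom F /\ forall i (x : Gs i), F (fprod_in x) = f i x.
Proof.
move=> homf; have [||F [homF FE]] := @word_map _ (@fprod_letter_inv I Gs)
    (@fprod_rel I Gs) K (fun l => f (tag l) (tagged l)).
- by case=> i x /=; rewrite (homV (homf i)).
- move=> u v [i|i x y]; rewrite !big_cons ?big_nil /= ?mulg1 ?homf //.
  by rewrite (hom1 (homf i)).
- by exists F; split=> // i x; rewrite FE big_seq1.
Qed.

(** The kernel of f is a normal subgroup containing R. *)
Lemma quot_by_map (G : groupType) (R : set G) (f : G -> K) :
  hom f -> (forall x, R x -> f x = 1) ->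
  exists F : quot_by R -> K, hom F /\ forall x, F (quot_by_pi R x) = f x.
Proof.
move=> homf fR; pose F (x : quot_by R) := f (generic_quotient.repr x).
have FE x : F (quot_by_pi R x) = f x.
  apply: (@mulgI _ (f x)^-1); rewrite mulVg -(homV homf) -homf /F.
  have ny := @repr_quot_by G R x.
  suff : kernel f (x^-1 * generic_quotient.repr (quot_by_pi R x)) by [].
  apply: ny; split; last by move=> z /fR.
  split; first exact: kernel_subgroup.
  by move=> a b _ fb; rewrite /kernel /= conjgE !homf fb mul1g -homf mulVg (hom1 homf).
exists F; split=> // x y; elim/quot_by_ind: x => x; elim/quot_by_ind: y => y.
have -> : quot_by_pi R x * quot_by_pi R y = quot_by_pi R (x * y) by apply: quot_by_piM.
by rewrite !FE homf.
Qed.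

End FreeMaps.

Lemma quot_by_pi_hom (G : groupType) (R : set G) : hom (quot_by_pi R).
Proof. by move=> x y; rewrite [RHS]/mul /= quot_by_piM. Qed.

Lemma fprod_in_hom (I : choiceType) (Gs : I -> groupType) i : hom (@fprod_in I Gs i).
Proof.
move=> x y; rewrite [RHS]/mul /= word_piM; apply/word_piE/WordSym.
by have := @WordRel _ (@fprod_letter_inv I Gs) (@fprod_rel I Gs) [::] [::] _ _ (FProdM x y).
Qed.

Section Pi1.
Variables (X : finite_graph) (G : graph_of_groups X) (T : {set edge X}).
Local Notation P1 := (pi1 G T).

Definition pi1_vin v (x : vgroup G v) : P1 := quot_by_pi _ (pi1_v x).
Definition pi1_edge e : P1 := quot_by_pi _ (pi1_e G e).

Lemma pi1_vin_hom v : hom (@pi1_vin v).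
Proof. by move=> x y; rewrite /pi1_vin /pi1_v fprod_in_hom quot_by_pi_hom. Qed.

Lemma pi1_relator1 x : pi1_relator T x -> quot_by_pi (@pi1_relator X G T) x = 1.
Proof.
move=> rx; apply/esym/quot_by_piE; rewrite invg1 mul1g.
by move=> N [_]; apply.
Qed.

Lemma pi1_bar e : pi1_edge (bar e) = (pi1_edge e)^-1.
Proof.
have := pi1_relator1 (RelBar G T e); rewrite quot_by_pi_hom => /mulg1_eq /esym.
exact.
Qed.

Lemma pi1_tree t : t \in T -> pi1_edge t = 1.
Proof. by move=> tT; apply: (pi1_relator1 (RelTree G tT)). Qed.

Lemma pi1_edge_rel e (g : egroup G e) :
  pi1_vin (emb G e g) * pi1_edge e =
  pi1_edge e * pi1_vin (emb G (bar e) (to_bar g)).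
Proof.
have := pi1_relator1 (RelEdge T g); rewrite !quot_by_pi_hom !(homV (@quot_by_pi_hom _ _)).
move/divg1_eq => eqg; rewrite -[pi1_vin (emb G (bar e) _)]eqg.
by rewrite !mulgA mulgV mul1g.
Qed.

Lemma pi1_ind (P : set P1) : subgroup P -> (forall v x, P (@pi1_vin v x)) ->
  (forall e, P (pi1_edge e)) -> forall x, P x.
Proof.
move=> sgP Pv Pe; elim/quot_by_ind => x.
pose Q : set (pi1_free G) := [set x | P (quot_by_pi _ x)].
suff : Q x by [].
have sgQ : subgroup Q.
  apply: subgroup_intro; rewrite /Q /=.
  - by rewrite (hom1 (@quot_by_pi_hom _ _)); apply: subgroup1.
  - by move=> a b Pa Pb; rewrite quot_by_pi_hom; apply: subgroupM.
  - by move=> a Pa; rewrite (homV (@quot_by_pi_hom _ _)); apply: subgroupV.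
apply: (word_subgroup sgQ) => -[[v|] y]; first exact: Pv.
pose S : set (free_group (edge X)) := [set y | Q (@fprod_in _ (pi1_factor G) None y)].
suff : S y by [].
have sgS : subgroup S.
  have homi := @fprod_in_hom _ (pi1_factor G) None.
  apply: subgroup_intro => [|a b|a]; rewrite /S /=.
  - by rewrite (hom1 homi); apply: subgroup1.
  - by move=> Qa Qb; rewrite homi; apply: subgroupM.
  - by move=> Qa; rewrite (homV homi); apply: subgroupV.
apply: (word_subgroup sgS) => -[e []]; last exact: Pe.
have -> : word_pi (@free_letter_inv (edge X)) (fun _ _ => False) [:: (e, true)] = (free_gen e)^-1.
  exact: esym (@word_piV _ (@free_letter_inv (edge X)) (fun _ _ => False) [:: (e, false)]).
by apply: subgroupV => //; apply: Pe.
Qed.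

Lemma pi1_map (K : groupType) (f : forall v, vgroup G v -> K) (k : edge X -> K) :
    (forall v, hom (@f v)) -> (forall e, k e * k (bar e) = 1) ->
    (forall t, t \in T -> k t = 1) ->
    (forall e (g : egroup G e),
      f _ (emb G e g) * k e = k e * f _ (emb G (bar e) (to_bar g))) ->
  exists F : P1 -> K, [/\ hom F, forall v x, F (@pi1_vin v x) = f v x &
                          forall e, F (pi1_edge e) = k e].
Proof.
move=> homf kbar kT krel; have [fe [homfe feE]] := free_group_map k.
pose fo o : pi1_factor G o -> K := if o is Some v then f v else fe.
have homfo o : hom (@fo o) by case: o.
have [F [homF FE]] := free_product_map homfo.
have Fv v x : F (@pi1_v _ G v x) = f v x by apply: (FE (Some v)).
have Fe e : F (pi1_e G e) = k e by rewrite (FE None) /= feE.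
have [|F1 [homF1 F1E]] := @quot_by_map K _ (@pi1_relator X G T) F homF.
  move=> _ [e|t tT|e g]; rewrite ?homF ?(homV homF) ?Fv ?Fe //; first exact: kT.
  by rewrite -(mulgA _ _ (k e)) krel mulKg mulgV.
by exists F1; split=> // [v x|e]; rewrite F1E.
Qed.

End Pi1.

Section Orientation.
Variables (X : finite_graph) (G : graph_of_groups X).

Lemma to_bar_hom e : hom (@to_bar X G e).
Proof.
move=> x y; rewrite /to_bar; move: (esym _) => p.
by move: (egroup G (bar e)) p => B p; case: B / p.
Qed.

Lemma to_bar_inj e : injective (@to_bar X G e).
Proof.
rewrite /to_bar; move: (esym _) => p.
by move: (egroup G (bar e)) p => B p; case: B / p.
Qed.

(** Going through [bar] twice returns to the original embedding; stated after a
    map into a fixed type, as the two embeddings have different types. *)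
Lemma emb_bar_bar e (g : egroup G e) (K : Type) (f : forall v, vgroup G v -> K) :
  f _ (emb G (bar (bar e)) (to_bar (to_bar g))) = f _ (emb G e g).
Proof.
have gen e' (eqe : e' = e) (p : egroup G e = egroup G e') :
    f _ (emb G e' (ecast B (B : groupType) p g)) = f _ (emb G e g).
  (* Proof irrelevance makes any cast from egroup e to itself the identity. *)
  by subst e'; rewrite (Prop_irrelevance p erefl).
rewrite -(gen _ (barK e) (etrans (esym (egroup_bar G e)) (esym (egroup_bar G (bar e))))).
congr (f _ (emb _ _ _)); rewrite /to_bar.
move: (esym (egroup_bar G e)) (esym (egroup_bar G (bar e))).
move: (egroup G (bar e)) (egroup G (bar (bar e))) => B C p q.
by case: C / q; case: B / p.
Qed.

(** One edge from each pair of opposite edges, chosen by an enumeration. *)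
Definition oriented : choiceType := {e : edge X | enum_rank e < enum_rank (bar e)}%N.

Lemma orient e : exists o : oriented, val o = e \/ val o = bar e.
Proof.
have [lt|ge] := ltnP (enum_rank e) (enum_rank (bar e)); first by exists (exist _ e lt); left.
have lt : (enum_rank (bar e) < enum_rank (bar (bar e)))%N.
  rewrite barK ltn_neqAle ge andbT; apply/eqP => /val_inj /enum_rank_inj /eqP.
  by rewrite (negPf (bar_neq e)).
by exists (exist _ (bar e) lt); right.
Qed.

Lemma oriented_bar (o o' : oriented) : val o <> bar (val o').
Proof.
move=> eqo; have := valP o; have := valP o'; rewrite /= eqo barK => lt1 lt2.
by have := ltn_trans lt1 lt2; rewrite ltnn.
Qed.

Local Notation P0 := (pi1 G finset.set0).

Lemma pi1_oriented_ind (P : set P0) : subgroup P ->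
  (forall v x, P (@pi1_vin _ _ _ v x)) ->
  (forall o : oriented, P (pi1_edge G _ (val o))) -> forall x, P x.
Proof.
move=> sgP Pv Pe; apply: pi1_ind => // e.
have [o [<- //|eqo]] := orient e.
by rewrite -[e]barK -eqo pi1_bar; apply: subgroupV.
Qed.

Lemma pi1_oriented_map (K : groupType) (f : forall v, vgroup G v -> K) (k : oriented -> K) :
    (forall v, hom (@f v)) ->
    (forall (o : oriented) (g : egroup G (val o)),
      f _ (emb G (val o) g) * k o = k o * f _ (emb G (bar (val o)) (to_bar g))) ->
  exists F : P0 -> K, [/\ hom F, forall v x, F (@pi1_vin _ _ _ v x) = f v x &
                          forall o : oriented, F (pi1_edge G _ (val o)) = k o].
Proof.
move=> homf krel.
pose k' e : K := if insub e is Some o then k o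
                 else if insub (bar e) is Some o then (k o)^-1 else 1.
have k'o (o : oriented) : k' (val o) = k o by rewrite /k' valK.
have k'b (o : oriented) : k' (bar (val o)) = (k o)^-1.
  rewrite /k'; case: insubP => [o' _ eqo|_]; first by case: (oriented_bar eqo).
  by rewrite barK valK.
have [|||F [homF Fv Fe]] := @pi1_map X G finset.set0 K f k' homf.
- move=> e; have [o [<-|eqo]] := orient e; first by rewrite k'o k'b mulgV.
  by rewrite -[e]barK -eqo k'b barK k'o mulVg.
- by move=> t; rewrite finset.in_set0.
- move=> e; have [o [<-|eqo]] := orient e; first by move=> g; rewrite k'o; apply: krel.
  (* For a reversed edge the relation is the inverse of the one for [bar e]. *)
  move=> g; have k'e : k' e = (k o)^-1 by rewrite -k'b eqo barK.
  have kr b (h : egroup G b) : val o = b ->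
      f _ (emb G b h) * k o = k o * f _ (emb G (bar b) (to_bar h)).
    by move=> eqb; case: b / eqb h => h; apply: krel.
  have := kr _ (to_bar g) eqo; rewrite emb_bar_bar k'e => /(congr1 (fun z => (k o)^-1 * z * (k o)^-1)).
  by rewrite mulKg !mulgA mulgK => <-.
- by exists F; split=> // o; rewrite Fe.
Qed.

Definition pi1_amalgam : amalgam P0.
Proof.
apply: (@Amalgam P0 (vertex X) (vgroup G) (@pi1_vin _ G _) oriented
  (fun o => src (val o)) (fun o => src (bar (val o))) (fun o => egroup G (val o))
  (fun o => emb G (val o)) (fun o g => emb G (bar (val o)) (to_bar g))
  (fun o => pi1_edge G _ (val o))).
- exact: pi1_vin_hom.
- by move=> o x y; rewrite gmulfM.
- by move=> o x y; rewrite to_bar_hom gmulfM.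
- by move=> o g; apply: pi1_edge_rel.
- exact: pi1_oriented_ind.
- exact: pi1_oriented_map.
Defined.

End Orientation.

(** * Getting rid of the tree relators *)

Lemma not_path_split (T : Type) (r : rel T) x s : ~~ path r x s ->
  exists a f g b, x :: s = a ++ [:: f, g & b] /\ ~~ r f g.
Proof.
elim: s x => [//|y s IHs] x /=; rewrite negb_and => /orP [nxy|/IHs [a [f [g [b [-> nfg]]]]]].
  by exists [::], x, y, s.
by exists (x :: a), f, g, b.
Qed.

Section TreePotential.
Variables (X : finite_graph) (T : {set edge X}).
Hypothesis treeT : spanning_tree T.

Fixpoint walk (u : vertex X) (s : seq (edge X)) (v : vertex X) : bool :=
  if s is e :: s' then [&& e \in T, src e == u & walk (src (bar e)) s' v] else u == v.

Lemma walk_cat u a b v : walk u (a ++ b) v -> exists2 w, walk u a w & walk w b v.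
Proof.
elim: a u => [|e a IHa] u /=; first by exists u.
by case/and3P=> -> -> /IHa [w ua wb]; exists w.
Qed.

Lemma cat_walk u a w b v : walk u a w -> walk w b v -> walk u (a ++ b) v.
Proof.
elim: a u => [|e a IHa] u /=; first by move/eqP->.
by case/and3P=> -> -> /IHa.
Qed.

Lemma walk_last u e s v : walk u (e :: s) v -> src (bar (last e s)) = v.
Proof.
elim: s u e => [|f s IHs] u e /=; first by case/and3P=> _ _ /eqP.
by case/and3P=> _ _ /IHs.
Qed.

Lemma walk_rev u s v : walk u s v -> walk v (rev (map (@bar X) s)) u.
Proof.
elim: s u => [|e s IHs] u /=; first by rewrite eq_sym.
case/and3P=> eT /eqP <- /IHs sv; rewrite rev_cons -cats1; apply: cat_walk sv _.
by rewrite /= barK !eqxx !andbT; case: treeT => barT _ _; apply: barT.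
Qed.

Variables (K : groupType) (k : edge X -> K).
Hypothesis kbar : forall e, k (bar e) = (k e)^-1.

(** A closed walk in a tree backtracks somewhere, and cancelling the backtrack
    changes neither its end points nor its value. *)
Lemma closed_walk1 u s : walk u s u -> \prod_(e <- s) k e = 1.
Proof.
have [n] := ubnP (size s); elim: n u s => // n IHn u [|e s] /=.
  by rewrite big_nil.
rewrite ltnS => les ws; have [_ _ acyc] := treeT.
have [eT srce _] := and3P ws.
(* A reduced walk cannot be closed, so some step f is followed by bar f. *)
have [red|nred] := boolP (path (reduced_step T) e s).
  by exfalso; apply: (acyc e s eT red); rewrite (eqP srce); apply: walk_last ws.
have [a [f [g [b [eqs nfg]]]]] := not_path_split nred.
have {}ws : walk u (e :: s) u by [].
rewrite eqs in ws *; have [w ua /= /and5P [fT /eqP fw gT /eqP gf wb]] := walk_cat ws.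
have gE : g = bar f by move: nfg; rewrite /reduced_step /= fT gT gf eqxx /= negbK => /eqP.
rewrite big_cat !big_cons gE kbar /= mulVKg -big_cat; apply: (IHn u).
  have /= := congr1 size eqs; rewrite !size_cat /= => -[eqsz].
  by rewrite (leq_trans _ les) // eqsz !addnS ltnS leqnSn.
by apply: cat_walk ua _; move: wb; rewrite gE barK fw.
Qed.

Lemma connected_walk u v : exists s, walk u s v.
Proof.
case: treeT => _ conn _; case/connectP: (conn u v) => p + ->.
elim: p u => [|w p IHp] u /=; first by exists [::] => /=.
case/andP=> /existsP [e /and3P [eT /eqP eu /eqP ew]] /IHp [s ws].
by exists (e :: s); rewrite /= eT eu ew eqxx.
Qed.

(** Over a tree, any edge labelling is the coboundary of a potential. *)
Lemma tree_potential (R : vertex X -> K -> Prop) v0 : R v0 1 ->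
    (forall t p, t \in T -> R (src t) p -> R (src (bar t)) (p * k t)) ->
  exists gamma, (forall v, R v (gamma v)) /\
    forall t, t \in T -> gamma (src t) * k t = gamma (src (bar t)).
Proof.
move=> R0 RT; pose s v := sval (cid (connected_walk v0 v)).
have ws v : walk v0 (s v) v := svalP (cid (connected_walk v0 v)).
exists (fun v => \prod_(e <- s v) k e); split=> [v|t tT].
  have gen p u q : R u q -> walk u p v -> R v (q * \prod_(e <- p) k e).
    elim: p u q => [|e p IHp] u q Rq /=; first by move/eqP <-; rewrite big_nil mulg1.
    case/and3P=> eT /eqP eu; rewrite big_cons mulgA; apply: IHp.
    by apply: RT; rewrite ?eu.
  by rewrite -[\prod_(_ <- _) _]mul1g; apply: gen R0 (ws v).
have := @closed_walk1 v0 (s (src t) ++ t :: rev (map (@bar X) (s (src (bar t))))).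
rewrite big_cat big_cons /=.
have -> : \prod_(e <- rev (map (@bar X) (s (src (bar t))))) k e =
    (\prod_(e <- s (src (bar t))) k e)^-1.
  elim: (s _) => [|e p IHp] /=; first by rewrite !big_nil invg1.
  by rewrite rev_cons -cats1 big_cat big_seq1 IHp big_cons invgM kbar.
rewrite mulgA => /(_ _)/divg1_eq; apply; apply: cat_walk (ws _) _.
by rewrite /= tT eqxx walk_rev.
Qed.

End TreePotential.

Section ReachGroup.
Variables (G : groupType) (D : amalgam G) (v0 : vert D).

Lemma reach_div v p q : reach v0 v p -> reach v0 v q -> reach v0 v0 (q * p^-1).
Proof.
move=> rp; elim: rp q => {v p} [|v p x _ IH|e p _ IH|e p _ IH] q rq.
- by rewrite invg1 mulg1.
- by rewrite invgM mulgA -(homV (@vin_hom _ D v)); apply/IH/ReachV.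
- by rewrite invgM mulgA; apply/IH/ReachEV.
- by rewrite invgM mulgA invgK; apply/IH/ReachE.
Qed.

Lemma reach_subgroup : subgroup (reach v0 v0).
Proof.
by apply/subgroupP; split=> [|x y rx ry]; [apply: Reach0|apply: reach_div ry rx].
Qed.

End ReachGroup.

Section Embedding.
Variables (X : finite_graph) (G : graph_of_groups X) (T : {set edge X}).
Hypothesis treeT : spanning_tree T.
Variable v0 : vertex X.
Local Notation P0 := (pi1 G finset.set0).
Local Notation reach0 := (@reach P0 (pi1_amalgam G) v0).

Lemma reach_edge e p : reach0 (src e) p -> reach0 (src (bar e)) (p * pi1_edge G finset.set0 e).
Proof.
have [o [<-|eqo]] := orient e; first exact: (@ReachE _ (pi1_amalgam G) v0 o).
move=> rp; have := @ReachEV _ (pi1_amalgam G) v0 o p; rewrite /= eqo barK.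
by rewrite pi1_bar invgK; apply.
Qed.

(** With gamma the potential of the labelling of tree edges by their stable letters,
    G_v is embedded through conjugation by gamma v, and an edge e is sent to
    gamma (src e) e gamma (src (bar e))^-1, which is 1 on the tree.  Killing the tree
    edges maps gamma v to 1 and so undoes this. *)
Lemma pi1_embedding : exists F : pi1 G T -> P0, exists R : P0 -> pi1 G T,
  [/\ hom F, hom R, cancel F R & forall x, reach0 v0 (F x)].
Proof.
have [|||R [homR Rv Re]] := @pi1_map X G finset.set0 (pi1 G T)
    (@pi1_vin X G T) (pi1_edge G T) (@pi1_vin_hom X G T).
- by move=> e; rewrite pi1_bar mulgV.
- by move=> t; rewrite finset.in_set0.
- by move=> e g; apply: pi1_edge_rel.
have [||gamma [gammaR gammaT]] := @tree_potential X T treeT P0 (pi1_edge G finset.set0)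
    (@pi1_bar X G finset.set0) (fun v p => reach0 v p /\ R p = 1) v0.
- by split; [apply: Reach0|apply: hom1].
- move=> t p tT [rp Rp]; split; first exact: reach_edge.
  by rewrite homR Rp Re (pi1_tree _ tT) mulg1.
pose f v (x : vgroup G v) : P0 := gamma v * pi1_vin _ x * (gamma v)^-1.
pose k e : P0 := gamma (src e) * pi1_edge G _ e * (gamma (src (bar e)))^-1.
have [||||F [homF Fv Fe]] := @pi1_map X G T P0 f k.
- by move=> v x y; rewrite /f pi1_vin_hom !mulgA mulgVK.
- by move=> e; rewrite /k barK pi1_bar !mulgA mulgVK mulgK mulgV.
- by move=> t tT; rewrite /k gammaT // mulgV.
- move=> e g; rewrite /f /k !mulgA !mulgVK; congr (_ * _).
  by rewrite -!(mulgA (gamma _)) pi1_edge_rel.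
exists F, R; split=> //.
  move=> x; suff : [set x | R (F x) = x] x by [].
  move: x; apply: pi1_ind.
  - apply: subgroup_intro => [|x y|x] /=; first by rewrite (hom1 homF) (hom1 homR).
      by move=> ex ey; rewrite homF homR ex ey.
    by move=> ex; rewrite (homV homF) (homV homR) ex.
  - move=> v x /=; rewrite Fv !homR (homV homR) (gammaR v).2 Rv.
    by rewrite mul1g invg1 mulg1.
  - move=> e /=; rewrite Fe !homR (homV homR) !(gammaR _).2 Re.
    by rewrite mul1g invg1 mulg1.
move=> x; suff : [set x | reach0 v0 (F x)] x by [].
have sgr := @reach_subgroup P0 (pi1_amalgam G) v0.
move: x; apply: pi1_ind => [|v x|e] /=.
- apply: subgroup_intro => [|x y|x] /=; first by rewrite (hom1 homF); apply: Reach0.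
    by move=> rx ry; rewrite homF; apply: (subgroupM sgr).
  by move=> rx; rewrite (homV homF); apply: (subgroupV sgr).
- rewrite Fv; apply: (@reach_div _ (pi1_amalgam G) v0 v); first exact: (gammaR v).1.
  exact: (@ReachV _ (pi1_amalgam G) v0 v _ x (gammaR v).1).
- rewrite Fe; apply: (@reach_div _ (pi1_amalgam G) v0 (src (bar e))).
    exact: (gammaR _).1.
  exact: reach_edge (gammaR _).1.
Qed.

End Embedding.

(** * The Takahasi property *)

Lemma finite_group_torsion (A : groupType) (g : A) :
  finite_set [set: A] -> exists n, g ^+ n.+1 = 1.
Proof.
move=> /finite_seqP [s allA]; have in_s x : x \in undup s.
  by rewrite mem_undup; have : [set: A] x by []; rewrite allA.
apply: contrapT => inf.
have injg : injective (fun i : 'I_(size (undup s)).+1 => SeqSub (in_s (g ^+ i))).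
  have key i k : (i < k)%N -> g ^+ i <> g ^+ k.
    move=> lt_ik eqg; apply: inf; exists (k - i).-1.
    rewrite prednK ?subn_gt0 //; apply: (@mulgI _ (g ^+ i)).
    by rewrite -expgnDr subnKC ?mulg1 // ltnW.
  move=> i k /(congr1 val) /= eqg; apply: val_inj.
  by have [/key|/key/nesym|//] := ltngtP i k; case.
by have := leq_card _ injg; rewrite card_ord card_seq_sub ?undup_uniq // ltnn.
Qed.

(** Poly-Z groups are torsion-free. *)
Lemma finite_meets_polyZ (A K : groupType) (N : set K) (j : A -> K) g :
  finite_set [set: A] -> hom j -> injective j -> polyZ N -> N (j g) -> g = 1.
Proof.
move=> finA homj injj pN Ng; have [n gn] := finite_group_torsion g finA.
apply: injj; rewrite (hom1 homj); apply: (polyZ_torsion_free (n := n) pN Ng).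
have homX m : j (g ^+ m) = j g ^+ m.
  by elim: m => [|m IHm]; rewrite ?(hom1 homj) // !expgS homj IHm.
by rewrite -homX gn (hom1 homj).
Qed.

Lemma image_generated (G K : groupType) (f : G -> K) (H : set G) s :
  hom f -> generated_by H s -> generated_by (f @` H) (map f s).
Proof.
move=> homf defH; have sgH := generated_by_subgroup defH.
apply: generated_by_intro.
- apply: subgroup_intro => [|_ _ [x Hx <-] [y Hy <-]|_ [x Hx <-]].
  + by exists 1; [apply: subgroup1|apply: hom1].
  + by exists (x * y); [apply: subgroupM|rewrite homf].
  + by exists x^-1; [apply: subgroupV|rewrite homV].
- move=> _ /mapP [x xs ->]; exists x => //.
  exact: generated_by_sub defH _ xs.
- move=> _ [x Hx <-].
  have sgs := gen_subgroupP [set` map f s].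
  suff : H `<=` [set x | gen_subgroup [set` map f s] (f x)] by apply.
  rewrite [X in X `<=` _]defH; apply: gen_subgroup_min => [|y ys /=].
    apply: subgroup_intro => [|y z|y] /=.
    + by rewrite (hom1 homf); apply: subgroup1 sgs.
    + by rewrite homf; apply: subgroupM sgs.
    + by rewrite (homV homf); apply: subgroupV sgs.
  by apply: gen_subgroup_sub; rewrite /= map_f.
Qed.

Section Main.
Variables (X : finite_graph) (G : graph_of_groups X).
Hypothesis vpcV : forall v : vertex X, virtually_polycyclic (vgroup G v).
Hypothesis finE : forall e : edge X, finite_set [set: egroup G e].
Local Notation P0 := (pi1 G finset.set0).
Local Notation D := (pi1_amalgam G).

(** Stable letters are sent to permutations that conjugate the two free actions of
    the edge group. *)
Lemma finite_quotient :
  exists (gT : finGroupType) (rho : P0 -> gT) (N : forall v, set (vgroup G v)),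
  [/\ hom rho, forall v, polyZ (@N v) &
      forall v (x : vgroup G v), rho (pi1_vin _ x) = 1 -> N v x].
Proof.
pose N v := sval (cid (virtually_polycyclic_normal_polyZ (vpcV v))).
have [pN nN cN] : [/\ forall v, polyZ (N v), forall v, normalises [set: vgroup G v] (N v) &
    forall v, coloured [set: vgroup G v] (N v)].
  by split=> v; case: (svalP (cid (virtually_polycyclic_normal_polyZ (vpcV v)))).
have sgN v : subgroup (N v) := polyZ_subgroup (pN v).
have [Om [rho [/card_gt0P [w0 _] homr freer]]] := common_coset_action sgN nN cN.
have free_in e v (j : egroup G e -> vgroup G v) : hom j -> injective j ->
    free_action (fun g => rho v (j g)).
  by move=> homj injj g w /freer; apply: finite_meets_polyZ (pN v).
have src_hom (o : oriented X) : hom (emb G (val o)) by move=> x y; rewrite gmulfM.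
have tgt_hom (o : oriented X) : hom (fun g => emb G (bar (val o)) (@to_bar X G (val o) g)).
  by move=> x y; rewrite to_bar_hom gmulfM.
have conj_o (o : oriented X) : {t : {perm Om} | forall g,
    rho _ (emb G (val o) g) * t = t * rho _ (emb G (bar (val o)) (to_bar g))}.
  apply: cid; apply: (finite_group_free_actions_conjugate (finE (val o))
    (j1 := fun g => rho _ (emb G (val o) g))
    (j2 := fun g => rho _ (emb G (bar (val o)) (to_bar g)))).
  - by move=> x y; rewrite src_hom homr.
  - by move=> x y; rewrite tgt_hom homr.
  - by apply: free_in => //; apply: emb_inj.
  - by apply: free_in => // x y /emb_inj /to_bar_inj.
have [F [homF Fv _]] : exists F : P0 -> {perm Om}, [/\ hom F,
    forall v (x : vgroup G v), F (pi1_vin _ x) = rho v x &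
    forall o : oriented X, F (pi1_edge G _ (val o)) = sval (conj_o o)].
  apply: pi1_oriented_map => // o g; exact: (svalP (conj_o o)).
exists {perm Om}, F, N; split=> // v x; rewrite Fv => rx1.
by apply: (freer v x w0); rewrite rx1 perm1.
Qed.

Variables (v0 : vertex X) (M : nat) (H : nat -> set P0).
Hypothesis chainH : bounded_chain M H.
Hypothesis reachH : forall j x, H j x -> @reach P0 D v0 v0 x.

Lemma reachable_chain_fin_gen : fin_gen (\bigcup_j H j).
Proof.
have [gT [rho [N [homr pN kerN]]]] := finite_quotient.
have sgU := chain_union_subgroup chainH.
apply: (fin_gen_of_kernel homr sgU).
have chainK : bounded_chain (#|gT| * M) (fun j => H j `&` kernel rho).
  split=> [j|j x [Hx kx]]; last by split=> //; apply: chainH.2.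
  have [s les defs] := chainH.1 j.
  have [t let_ deft] := kernel_generated homr (chain_subgroup chainH j) defs.
  by exists t => //; apply: leq_trans let_ _; rewrite leq_mul2l les orbT.
rewrite setI_bigcupl; set U := \bigcup_j _.
have sgUK : subgroup U := chain_union_subgroup chainK.
have kerU v p (x : vgroup G v) : U (p * pi1_vin _ x * p^-1) -> N v x.
  case=> j _ [_]; rewrite /kernel /= !homr (homV homr) => eq1; apply: kerN.
  by apply: (@mulgI _ (rho p)); apply: (@mulIg _ (rho p)^-1); rewrite eq1 mulg1 mulgV.
have stabN v p : polyZ (stab U (@pi1_vin X G _ v) p).
  apply: polyZ_sub (pN v) (stab_subgroup sgUK (@pi1_vin_hom X G _ v) p) _.
  by move=> x /kerU.
apply: (@subgroup_fin_gen P0 D U v0 _ sgUK (chain_dual_bound chainK)).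
- move=> o p g /kerU.
  exact: (finite_meets_polyZ (finE _) (@ein_src_hom P0 D o) (@emb_inj _ G _) (pN _)).
- move=> o p g /kerU.
  apply: (finite_meets_polyZ (finE _) (@ein_tgt_hom P0 D o) _ (pN _)).
  by move=> x y /emb_inj /to_bar_inj.
- by move=> v p; apply/polyZ_fin_gen/stabN.
- by move=> v p x sx x1; apply: polyZ_parity (stabN v p) sx x1.
- by move=> x [j _ [/reachH]].
Qed.

End Main.

Theorem corollary4p4 (X : finite_graph) (G : graph_of_groups X)
    (T : {set edge X})
    (connX : connected_graph X) (treeT : spanning_tree T)
    (vpcV : forall v : vertex X, virtually_polycyclic (vgroup G v))
    (finE : forall e : edge X, finite_set (@setT (egroup G e))) :
  takahasi (pi1 G T).
Proof.
have /card_gt0P [v0 _] := vertex_gt0 X.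
have [F [R [homF homR FK reachF]]] := pi1_embedding G treeT v0.
apply: takahasi_criterion => M H chainH.
have chainF : bounded_chain M (fun j => F @` H j).
  split=> [j|j _ [x Hx <-]]; last by exists x => //; apply: chainH.2.
  have [s les defs] := chainH.1 j; exists (map F s); first by rewrite size_map.
  exact: image_generated.
have : fin_gen (\bigcup_j F @` H j).
  by apply: (reachable_chain_fin_gen vpcV finE chainF) => j _ [x _ <-]; apply: reachF.
case/fin_genP=> t /(image_generated homR) deft; apply/fin_genP; exists (map R t).
suff <- : R @` (\bigcup_j F @` H j) = \bigcup_j H j by [].
apply/seteqP; split=> [_ [_ [j _ [x Hx <-]] <-]|x [j _ Hx]].
  by exists j => //; rewrite FK.
by exists (F x); [exists j => //; exists x|rewrite FK].
Qed.
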